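(* Let $[f_n]$ and $[g_n]$ be tempered generalized functions, $a=[a_n]\in\mathbf{h}$ and $\alpha\in\mathbb{N}$. Let $A\subset\mathbb{R}$ be a Lebesgue measurable set. Then the following hold in $\mathbf{h}$. (a) If $A$ and $B$ are disjoint Lebesgue measurable sets, then $$\int_{A\cup B}[f_n](x)\,dx=\int_A[f_n](x)\,dx+\int_B[f_n](x)\,dx.$$ (b) $$\int_A([f_n]+a[g_n])(x)\,dx=\int_A[f_n](x)\,dx+a\int_A[g_n](x)\,dx.$$ (c) Let $\varphi\in\mathcal{S}$. Then $\iota\big(\int_A\varphi\,dx\big)=\int_A\iota(\varphi)\,dx$. (d) (Rule of integration by parts) $$\int_{\mathbb{R}}[f_n]\,D^\alpha[g_n](x)\,dx=(-1)^\alpha\int_{\mathbb{R}}(D^\alpha[f_n])\,[g_n](x)\,dx.$$ (e) Let $\varphi\in\mathcal{S}$ and $T\in\mathcal{S}'$. Then $\int_{\mathbb{R}}\iota(T)\cdot\iota(\varphi)(x)\,dx=\iota(T(\varphi))$.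
   Context: $\mathbb{N}_0=\mathbb{N}\cup\{0\}$. $\mathcal{S}$ is the Schwartz space of rapidly decreasing smooth real-valued functions on $\mathbb{R}$, with norms $\|\varphi\|_m=\big(\int_{\mathbb{R}}|(N+1)^m\varphi(x)|^2dx\big)^{1/2}$, $m\in\mathbb{N}_0$, where $N+1=\frac12\big(-\frac{d^2}{dx^2}+x^2+1\big)$; $\mathcal{S}'$ is the space of tempered distributions, and $\mathcal{S}\subset\mathcal{S}'$ in the usual way. The Hermite functions are $h_n(x)=(\sqrt{2\pi}\,n!)^{-1/2}e^{-x^2/4}H_n(x)$ with $H_n(x)=(-1)^ne^{x^2/2}\frac{d^n}{dx^n}e^{-x^2/2}$, $n\in\mathbb{N}_0$. $\mathbf{s}$ is the space of real sequences $(a_n)_{n\in\mathbb{N}_0}$ with $\sum_n (n+1)^{2m}|a_n|^2<\infty$ for all $m\in\mathbb{N}_0$. $\mathbf{s}'$ is the space of real sequences $(b_n)$ for which there are $C\in\mathbb{R}$, $m\in\mathbb{N}_0$ with $|b_n|\le C(n+1)^m$ for all $n$. The ring of tempered numbers is $\mathbf{h}=\mathbf{s}'/\mathbf{s}$ (pointwise operations); $[b_n]$ is the class of $(b_n)$. For a real number $a$, $\iota(a)=[a]\in\mathbf{h}$ is the class of the constant sequence. $\mathcal{H}_{\mathbf{s}'}$ (resp. $\mathcal{H}_{\mathbf{s}}$) is the set of sequences $(f_n)\in\mathcal{S}^{\mathbb{N}_0}$ such that $(\|f_n\|_m)_n\in\mathbf{s}'$ (resp. $\in\mathbf{s}$)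 for every $m\in\mathbb{N}_0$. The tempered algebra is $\mathcal{H}=\mathcal{H}_{\mathbf{s}'}/\mathcal{H}_{\mathbf{s}}$ with termwise operations; its elements are the tempered generalized functions, $[f_n]$ is the class of $(f_n)$, $D[f_n]=[Df_n]$, and $\mathcal{H}$ is an $\mathbf{h}$-module via $[a_n][f_n]=[a_nf_n]$. For distributions, $\iota:\mathcal{S}'\to\mathcal{H}$ is $\iota(T)=[T_n]$ with $T_n=\sum_{j=0}^nT(h_j)h_j$. Integral: for $A$ Lebesgue measurable, $\int_A[f_n](x)\,dx=\big[\int_Af_n(x)\,dx\big]\in\mathbf{h}$. *)

(* Defs.v *)
From HB Require Import structures.
From mathcomp Require Import all_boot all_order all_algebra.
From mathcomp Require Import all_classical all_reals all_analysis.
From mathcomp Require Import measurable_realfun.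
From mathcomp Require Import ring lra.
Set Implicit Arguments.
Unset Strict Implicit.
Unset Printing Implicit Defensive.
Import Order.TTheory GRing.Theory Num.Theory.
Import numFieldNormedType.Exports.
Local Open Scope ring_scope.
Local Open Scope classical_set_scope.

Definition is_schwartz (R : realType) (f : R -> R) : Prop :=
  (forall n x, derivable (derive1n n f) x 1) /\
  (forall a b : nat, exists C : R, forall x, `|x ^+ a * derive1n b f x| <= C).

Section schwartz_closure.
Variable R : realType.
Implicit Types (f g : R -> R).

Definition rapidly_decreasing f :=
  forall a : nat, exists C : R, forall x, `|x ^+ a * f x| <= C.

Lemma is_schwartz_coind (K : set (R -> R)) :
  (forall f, K f -> [/\ forall x, derivable f x 1, K (derive1 f) &
     rapidly_decreasing f]) ->
  forall f, K f -> is_schwartz f.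
Proof.
move=> KP f Kf.
have Kn n : K (derive1n n f).
  by elim: n => [//|n IH]; rewrite derive1nS; case: (KP _ IH).
by split=> [n|a b]; [case: (KP _ (Kn n))|case: (KP _ (Kn b)) => _ _ /(_ a)].
Qed.

Lemma is_schwartz_derivable f x : is_schwartz f -> derivable f x 1.
Proof. by case=> /(_ 0 x). Qed.

Lemma is_schwartz_rapid f : is_schwartz f -> rapidly_decreasing f.
Proof. by case=> _ + a => /(_ a 0). Qed.

Lemma is_schwartz_derive1 f : is_schwartz f -> is_schwartz (derive1 f).
Proof.
case=> df bf; split=> [n x|a b]; first by rewrite -derive1Sn; exact: df.
by have [C hC] := bf a b.+1; exists C => x; rewrite -derive1Sn.
Qed.

Lemma rapidly_decreasingD f g : rapidly_decreasing f -> rapidly_decreasing g ->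
  rapidly_decreasing (f + g).
Proof.
move=> rf rg a; have [C hC] := rf a; have [E hE] := rg a; exists (C + E) => x.
by rewrite mulrDr (le_trans (ler_normD _ _))// lerD.
Qed.

Lemma rapidly_decreasingM f g : rapidly_decreasing f -> rapidly_decreasing g ->
  rapidly_decreasing (f * g).
Proof.
move=> rf rg a; have [C hC] := rf a; have [E hE] := rg 0; exists (C * E) => x.
have := hE x; rewrite expr0 mul1r => hEx.
by rewrite mulrA normrM ler_pM.
Qed.

Lemma derive1_fctD f g : is_schwartz f -> is_schwartz g ->
  derive1 (f + g) = derive1 f + derive1 g.
Proof.
move=> sf sg; apply/funext => x.
rewrite derive1E deriveD; [|exact: is_schwartz_derivable..].
by rewrite -!derive1E.
Qed.

Lemma derive1_fctM f g : is_schwartz f -> is_schwartz g ->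
  derive1 (f * g) = derive1 f * g + f * derive1 g.
Proof.
move=> sf sg; apply/funext => x.
rewrite derive1E deriveM; [|exact: is_schwartz_derivable..].
rewrite -!derive1E [LHS]addrC; congr (_ + _); exact: mulrC.
Qed.

Lemma derive1_fctZ a f : is_schwartz f -> derive1 (a *: f) = a *: derive1 f.
Proof.
move=> sf; apply/funext => x; rewrite derive1E deriveZ.
  by rewrite -derive1E.
exact: is_schwartz_derivable.
Qed.

Lemma is_schwartz0 : is_schwartz (0 : R -> R).
Proof.
apply: (@is_schwartz_coind [set 0]) => // f ->; split=> [x||a] /=.
- exact: derivable_cst.
- by apply/funext => x; rewrite derive1_cst.
- by exists 0 => x; rewrite mulr0 normr0.
Qed.

Lemma is_schwartzD f g : is_schwartz f -> is_schwartz g -> is_schwartz (f + g).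
Proof.
move=> sf sg.
apply: (@is_schwartz_coind [set u | exists f g,
  [/\ is_schwartz f, is_schwartz g & u = f + g]]); last by exists f, g.
move=> _ [{sf}f [{sg}g [sf sg ->]]]; split=> [x||].
- by apply: derivableD; exact: is_schwartz_derivable.
- by exists (derive1 f), (derive1 g); rewrite derive1_fctD//; split => //;
    exact: is_schwartz_derive1.
- by apply: rapidly_decreasingD; exact: is_schwartz_rapid.
Qed.

Lemma is_schwartzZ a f : is_schwartz f -> is_schwartz (a *: f).
Proof.
move=> sf.
apply: (@is_schwartz_coind [set u | exists2 f, is_schwartz f & u = a *: f]).
  move=> _ [{sf}f sf ->]; split=> [x||b].
  - by apply: derivableZ; exact: is_schwartz_derivable.
  - by exists (derive1 f); rewrite ?derive1_fctZ//; exact: is_schwartz_derive1.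
  - have [C hC] := is_schwartz_rapid sf b; exists (`|a| * C) => x.
    rewrite (_ : _ * _ = a * (x ^+ b * f x)) ?normrM ?ler_wpM2l//.
      by rewrite -normrM.
    by rewrite mulrCA.
by exists f.
Qed.

Lemma is_schwartzM f g : is_schwartz f -> is_schwartz g -> is_schwartz (f * g).
Proof.
move=> sf sg.
pose F (s : seq ((R -> R) * (R -> R))) : R -> R := \sum_(p <- s) p.1 * p.2.
pose ok (s : seq ((R -> R) * (R -> R))) :=
  forall p, p \in s -> is_schwartz p.1 /\ is_schwartz p.2.
have okc p s : ok (p :: s) -> [/\ is_schwartz p.1, is_schwartz p.2 & ok s].
  move=> h; have [] := h p (mem_head _ _); split=> // q qs.
  by apply: h; rewrite inE qs orbT.
have FE p s : F (p :: s) = p.1 * p.2 + F s by rewrite /F big_cons.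
have dF s x : ok s -> derivable (F s) x 1.
  rewrite /F; elim: s => [_|p s IH /okc[s1 s2 /IH ds]].
    by rewrite big_nil; exact: derivable_cst.
  rewrite big_cons; apply: derivableD => //.
  by apply: derivableM; exact: is_schwartz_derivable.
apply: (@is_schwartz_coind [set u | exists2 s, ok s & u = F s]); last first.
  exists [:: (f, g)]; last by rewrite /F big_seq1.
  by move=> p; rewrite inE => /eqP->.
move=> _ [s oks ->]; split=> [x||]; first exact: dF.
- exists (flatten [seq [:: (derive1 p.1, p.2); (p.1, derive1 p.2)] | p <- s]).
    elim: s oks => [//|p s IH /okc[s1 s2 /IH oks]] q /=.
    rewrite !inE => /or3P[/eqP->|/eqP->|]; last exact: oks.
    + by split=> //; exact: is_schwartz_derive1.
    + by split=> //; exact: is_schwartz_derive1.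
  elim: s oks => [_|p s IH /okc[s1 s2 oks]] /=.
    by rewrite /F !big_nil; apply/funext => x; rewrite derive1_cst.
  rewrite !FE -IH//= addrA -derive1_fctM//.
  apply/funext => x; rewrite derive1E deriveD; last exact: dF.
    by rewrite -!derive1E.
  by apply: derivableM; exact: is_schwartz_derivable.
- elim: s oks => [_ a|p s IH /okc[s1 s2 /IH rs]].
    by exists 0 => x; rewrite /F big_nil mulr0 normr0.
  rewrite FE; apply: rapidly_decreasingD => //.
  by apply: rapidly_decreasingM; exact: is_schwartz_rapid.
Qed.

Lemma is_schwartz_mulX f : is_schwartz f -> is_schwartz (id * f).
Proof.
move=> sf.
apply: (@is_schwartz_coind [set u | exists f g,
  [/\ is_schwartz f, is_schwartz g & u = id * f + g]]); last first.
  by exists f, 0; split; rewrite ?addr0//; exact: is_schwartz0.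
move=> _ [{sf}f [g [sf sg ->]]]; split=> [x||].
- apply: derivableD; last exact: is_schwartz_derivable.
  by apply: derivableM; [exact: derivable_id|exact: is_schwartz_derivable].
- exists (derive1 f), (f + derive1 g); split.
  + exact: is_schwartz_derive1.
  + by apply: is_schwartzD => //; exact: is_schwartz_derive1.
  + have df x : derivable f x 1 by exact: is_schwartz_derivable.
    have dg x : derivable g x 1 by exact: is_schwartz_derivable.
    apply/funext => x; rewrite derive1E deriveD//; last exact: derivableM.
    rewrite deriveM// derive_id -!derive1E -addrA; congr (_ + _).
    by rewrite [X in X + _]mulr1.
- apply: rapidly_decreasingD; last exact: is_schwartz_rapid.
  move=> a; have [C hC] := is_schwartz_rapid sf a.+1; exists C => x.
  by rewrite mulrA -exprSr.
Qed.

End schwartz_closure.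

Section hermite.
Variable R : realType.
Implicit Types (p : {poly R}) (c x : R).

Definition hermite_poly (n : nat) x : R :=
  (-1) ^+ n * expR (x ^+ 2 / 2) * derive1n n (fun y => expR (- (y ^+ 2 / 2))) x.

Definition hermite_fun (n : nat) x : R :=
  (Num.sqrt (Num.sqrt (2 * pi) * n`!%:R))^-1 * expR (- (x ^+ 2 / 4))
  * hermite_poly n x.

Let poly_gauss c p x := p.[x] * expR (- (x ^+ 2 / c)).

Let is_derive_gauss c x :
  is_derive x 1 (fun y => expR (- (y ^+ 2 / c)))
            (- (2 / c * x) * expR (- (x ^+ 2 / c))).
Proof.
have d1 : is_derive x 1 (fun y : R => - (y ^+ 2 / c)) (- (2 / c * x)).
  apply: is_derive_eq.
  by rewrite /GRing.scale/=; ring.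
have := @is_derive1_comp _ expR (fun y : R => - (y ^+ 2 / c)) x _ _ (is_derive_expR _) d1.
by rewrite mulrC.
Qed.

Let is_derive_poly_gauss c p x :
  is_derive x 1 (poly_gauss c p)
    (poly_gauss c (p^`() - (2 / c) *: ('X * p)) x).
Proof.
have h1 := is_derive_poly p x; have h2 := is_derive_gauss c x.
apply: (is_derive_eq (is_deriveM h1 h2)).
rewrite /poly_gauss /GRing.scale/= hornerD hornerN hornerZ hornerM hornerX.
ring.
Qed.

Let derive1_poly_gauss c p :
  derive1 (poly_gauss c p) = poly_gauss c (p^`() - (2 / c) *: ('X * p)).
Proof. by apply/funext => x; rewrite derive1E; exact: derive_val. Qed.

Let rapidly_decreasing_gauss c : 0 < c ->
  rapidly_decreasing (fun x => expR (- (x ^+ 2 / c))).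
Proof.
move=> c0 a; exists (1 + a.+1`!%:R * c ^+ a.+1) => x.
rewrite normrM normrX [X in _ * X]ger0_norm ?expR_ge0// expRN.
rewrite ler_pdivrMr ?expR_gt0//.
have y0 : 0 <= x ^+ 2 / c by rewrite divr_ge0 ?sqr_ge0// ltW.
have := expR_ge1Dxn a y0; set e := expR _ => he.
have f0 : 0 < a.+1`!%:R :> R by rewrite ltr0n fact_gt0.
have c1 : 0 < c ^+ a.+1 by rewrite exprn_gt0.
have e1 : 1 <= e by rewrite (le_trans _ he)// lerDl divr_ge0 ?exprn_ge0.
rewrite mulrDl mul1r; have [x1|x1] := leP `|x| 1.
  rewrite (le_trans (exprn_ile1 _ (normr_ge0 _) x1))// (le_trans e1)// lerDl.
  by rewrite !mulr_ge0 ?(ltW f0) ?(ltW c1) ?(le_trans _ e1).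
have : `|x| ^+ a <= a.+1`!%:R * c ^+ a.+1 * e; last first.
  by move/le_trans; apply; rewrite lerDr (le_trans _ e1).
have {}he : (x ^+ 2 / c) ^+ a.+1 / a.+1`!%:R <= e by rewrite (le_trans _ he)// lerDr.
move: he; rewrite ler_pdivrMr// expr_div_n ler_pdivrMr// => h.
rewrite mulrC mulrA; apply: le_trans h; rewrite -real_normK ?num_real// -exprM.
by apply: ler_weXn2l; [exact: ltW|rewrite (leq_trans (leqnSn a))// leq_pmull].
Qed.

Let rapidly_decreasing_poly_gauss c p : 0 < c -> rapidly_decreasing (poly_gauss c p).
Proof.
move=> c0; elim/poly_ind: p => [a|p k IH].
  by exists 0 => x; rewrite /poly_gauss horner0 mul0r mulr0 normr0.
have -> : poly_gauss c (p * 'X + k%:P) =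
    (fun x => x * poly_gauss c p x) + (fun x => k * expR (- (x ^+ 2 / c))).
  apply/funext => x; rewrite /poly_gauss hornerD hornerM hornerX hornerC.
  by rewrite mulrDl -mulrA mulrCA.
apply: rapidly_decreasingD => a.
  by have [C hC] := IH a.+1; exists C => x; rewrite mulrA -exprSr.
have [C hC] := rapidly_decreasing_gauss c0 a; exists (`|k| * C) => x.
by rewrite mulrCA normrM ler_wpM2l.
Qed.

Let is_schwartz_poly_gauss c p : 0 < c -> is_schwartz (poly_gauss c p).
Proof.
move=> c0; apply: (@is_schwartz_coind _ [set f | exists p, f = poly_gauss c p]);
  last by exists p.
move=> _ [q ->]; split=> [x||].
- by case: (is_derive_poly_gauss c q x).
- by rewrite derive1_poly_gauss; eexists.
- exact: rapidly_decreasing_poly_gauss.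
Qed.

Lemma is_schwartz_hermite_fun n : is_schwartz (hermite_fun n).
Proof.
have [p hp] : exists p, derive1n n (fun y : R => expR (- (y ^+ 2 / 2))) = poly_gauss 2 p.
  elim: n => [|n [p IH]].
    by exists 1; apply/funext => x; rewrite derive1n0 /poly_gauss hornerC mul1r.
  by exists (p^`() - (2 / 2) *: ('X * p)); rewrite derive1nS IH derive1_poly_gauss.
suff -> : hermite_fun n = poly_gauss 4
   (((Num.sqrt (Num.sqrt (2 * pi) * n`!%:R))^-1 * (-1) ^+ n) *: p).
  exact: is_schwartz_poly_gauss.
apply/funext => x; rewrite /hermite_fun /hermite_poly hp /poly_gauss hornerZ.
rewrite [expR (- (x ^+ 2 / 2))]expRN; have := expR_gt0 (x ^+ 2 / 2) => /lt0r_neq0.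
by move=> e0; set r := (Num.sqrt _)^-1; field.
Qed.

End hermite.

Definition schwartz_pred (R : realType) : {pred R -> R} := 
  fun f => `[< is_schwartz f >].
Arguments schwartz_pred R : clear implicits.

Lemma schwartz_submod_closed (R : realType) : submod_closed (schwartz_pred R).
Proof.
split; first by apply/asboolP; exact: is_schwartz0.
move=> a f g /asboolP sf /asboolP sg; apply/asboolP.
by apply: is_schwartzD => //; exact: is_schwartzZ.
Qed.

HB.instance Definition _ (R : realType) :=
  GRing.isSubmodClosed.Build R (R -> R) (schwartz_pred R)
    (schwartz_submod_closed R).

Record schwartz (R : realType) := Schwartz {
  schwartz_fun :> R -> R;
  schwartzP : schwartz_fun \in schwartz_pred R }.

HB.instance Definition _ (R : realType) := [isSub for @schwartz_fun R].
HB.instance Definition _ (R : realType) := [Choice of schwartz R by <:].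
HB.instance Definition _ (R : realType) :=
  [SubChoice_isSubLmodule of schwartz R by <:].

Section schwartz_operations.
Variable R : realType.
Implicit Types (f g : schwartz R).

Lemma schwartz_is_schwartz f : is_schwartz f.
Proof. exact/asboolP/schwartzP. Qed.

Definition to_schwartz (u : R -> R) (su : is_schwartz u) : schwartz R :=
  Schwartz (asboolT su : u \in schwartz_pred R).

Definition schwartzM f g : schwartz R :=
  to_schwartz (is_schwartzM (schwartz_is_schwartz f) (schwartz_is_schwartz g)).

Definition schwartz_deriv f : schwartz R :=
  to_schwartz (is_schwartz_derive1 (schwartz_is_schwartz f)).

Definition schwartz_mulX f : schwartz R :=
  to_schwartz (is_schwartz_mulX (schwartz_is_schwartz f)).

Definition hermite (n : nat) : schwartz R :=
  to_schwartz (is_schwartz_hermite_fun R n).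

(* the operator N + 1 = (- d^2/dx^2 + x^2 + 1) / 2 *)
Definition numberop1 f : schwartz R :=
  2^-1 *: (- schwartz_deriv (schwartz_deriv f)
           + schwartz_mulX (schwartz_mulX f) + f).

Definition schwartz_norm (m : nat) f : R :=
  Num.sqrt (\int[lebesgue_measure]_(x in setT) `|iter m numberop1 f x| ^+ 2).

End schwartz_operations.

Section schwartz_norm_theory.
Variable R : realType.
Implicit Types (f g u v : schwartz R).

Local Notation mu := (@lebesgue_measure R).

Let numberop1D f g : numberop1 (f + g) = numberop1 f + numberop1 g.
Proof.
have sf := schwartz_is_schwartz f; have sg := schwartz_is_schwartz g.
apply: val_inj; rewrite /= derive1_fctD// derive1_fctD;
  [|exact: is_schwartz_derive1..].
rewrite -[RHS]scalerDr; congr (_ *: _).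
by rewrite !mulrDr opprD [X in X + _ = _]addrACA [LHS]addrACA.
Qed.

Let numberop1N f : numberop1 (- f) = - numberop1 f.
Proof.
apply/eqP; rewrite -addr_eq0 -numberop1D addNr; apply/eqP.
have := numberop1D 0 0; rewrite addr0 => /eqP.
by rewrite -[X in X == _]addr0 (inj_eq (addrI _)) => /eqP.
Qed.

Let schwartz_continuous u : continuous u.
Proof.
move=> x; apply/differentiable_continuous/derivable1_diffP.
exact: is_schwartz_derivable (schwartz_is_schwartz u).
Qed.

Let integrable_sqr u : mu.-integrable setT (EFin \o (fun x => `|u x| ^+ 2)).
Proof.
have c1 : continuous (fun x : R => (oneDsqr x)^-1) by exact: continuous_oneDsqrV.
have i1 : mu.-integrable setT (EFin \o (fun x : R => (oneDsqr x)^-1)).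
  apply/integrableP; split.
    by apply/measurable_EFinP; exact: continuous_measurable_fun.
  under eq_integral do rewrite gee0_abs ?lee_fin ?invr_ge0//.
  rewrite ge0_symfun_integralT//=; last first.
    by move=> x; rewrite /= /oneDsqr sqrrN.
  rewrite (_ : [set x | _] = `[0, +oo[%classic); last first.
    by apply/seteqP; split => x/=; rewrite in_itv/= andbT.
  by rewrite integral0y_oneDsqr lte_mul_pinfty ?ltry ?lee_fin.
have [C hC] := is_schwartz_rapid (schwartz_is_schwartz u) 0.
have [E hE] := is_schwartz_rapid (schwartz_is_schwartz u) 1.
apply: (le_integrable measurableT _ _
  (integrableZl measurableT (C ^+ 2 + E ^+ 2) i1)).
  apply/measurable_EFinP/measurable_funX/measurableT_comp => //.
  exact: continuous_measurable_fun.
move=> x _; rewrite /= lee_fin.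
have d0 : 0 < oneDsqr x :> R by rewrite /oneDsqr ltr_pwDl// sqr_ge0.
rewrite ger0_norm ?exprn_ge0// [leRHS]ger0_norm; last first.
  by rewrite mulr_ge0 ?addr_ge0 ?sqr_ge0// invr_ge0 ltW.
rewrite ler_pdivlMr// /oneDsqr mulrDr mulr1 lerD//.
  by rewrite ler_pXn2r ?nnegrE ?(le_trans _ (hC x))//; have := hC x; rewrite expr0 mul1r.
rewrite -(real_normK (num_real x)) -exprMn -normrM mulrC.
by rewrite ler_pXn2r ?nnegrE ?(le_trans _ (hE x))//; have := hE x; rewrite expr1.
Qed.

Let iterD m f g : iter m (@numberop1 R) (f + g) = iter m (@numberop1 R) f + iter m (@numberop1 R) g.
Proof. by elim: m => //= m ->; rewrite numberop1D. Qed.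

Let iterN m f : iter m (@numberop1 R) (- f) = - iter m (@numberop1 R) f.
Proof. by elim: m => //= m ->; rewrite numberop1N. Qed.

Lemma schwartz_norm_ge0 m f : 0 <= schwartz_norm m f.
Proof. exact: sqrtr_ge0. Qed.

Lemma schwartz_normN m f : schwartz_norm m (- f) = schwartz_norm m f.
Proof.
by rewrite /schwartz_norm iterN; congr Num.sqrt; apply: eq_Rintegral => x _; rewrite normrN.
Qed.

Lemma schwartz_norm0 m : schwartz_norm m (0 : schwartz R) = 0.
Proof.
have -> : 0 = 0 - 0 :> schwartz R by rewrite subr0.
rewrite /schwartz_norm iterD iterN subrr.
by rewrite /Rintegral integral0_eq ?sqrtr0// => x _; rewrite normr0 expr0n.
Qed.

Lemma schwartz_normD m f g :
  schwartz_norm m (f + g) <= 2 * (schwartz_norm m f + schwartz_norm m g).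
Proof.
rewrite /schwartz_norm iterD; set u := iter m _ f; set v := iter m _ g.
pose U := Rintegral mu setT (fun x => `|u x| ^+ 2).
pose V := Rintegral mu setT (fun x => `|v x| ^+ 2).
rewrite -/U -/V.
have U0 : 0 <= U by apply: Rintegral_ge0 => x _; rewrite sqr_ge0.
have V0 : 0 <= V by apply: Rintegral_ge0 => x _; rewrite sqr_ge0.
have := sqrtr_ge0 U; have := sqrtr_ge0 V.
have := sqr_sqrtr U0; have := sqr_sqrtr V0.
set a := Num.sqrt U; set b := Num.sqrt V => hb ha b0 a0.
rewrite -(ler_pXn2r (n := 2)) ?nnegrE ?sqrtr_ge0 ?mulr_ge0 ?addr_ge0//.
rewrite sqr_sqrtr; last by apply: Rintegral_ge0 => x _; rewrite sqr_ge0.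
apply: (@le_trans _ _ (2 * U + 2 * V)); last by rewrite -ha -hb; nra.
rewrite -!RintegralZl//; [|exact: integrable_sqr..].
have iu : mu.-integrable setT (EFin \o (fun x => 2 * `|u x| ^+ 2)).
  exact: (integrableZl measurableT 2 (integrable_sqr u)).
have iv : mu.-integrable setT (EFin \o (fun x => 2 * `|v x| ^+ 2)).
  exact: (integrableZl measurableT 2 (integrable_sqr v)).
rewrite -RintegralD//.
apply: le_Rintegral => //; first exact: (integrableD measurableT iu iv).
move=> x _; rewrite [X in `|X|](_ : _ = u x + v x)//.
rewrite !real_normK ?num_real//; move: (u x) (v x) => p q.
by have := sqr_ge0 (p - q); nra.
Qed.

End schwartz_norm_theory.

Definition tempered_seq_pred (R : realType) : {pred nat -> R} := fun b =>
  `[< exists (C : R) (m : nat), forall n, `|b n| <= C * n.+1%:R ^+ m >].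
Arguments tempered_seq_pred R : clear implicits.

Definition rapid_seq_pred (R : realType) : {pred nat -> R} := fun a =>
  `[< forall m : nat,
      (\sum_(0 <= n <oo) (n.+1%:R ^+ (2 * m) * `|a n| ^+ 2)%:E < +oo)%E >].
Arguments rapid_seq_pred R : clear implicits.

Section sequence_closure.
Variable R : realType.
Implicit Types a b u v w : nat -> R.

Lemma tempered_seq_le u v w (C : R) : u \in tempered_seq_pred R ->
  v \in tempered_seq_pred R -> (forall n, `|w n| <= C * (`|u n| + `|v n|)) ->
  w \in tempered_seq_pred R.
Proof.
move=> /asboolP[A [k hA]] /asboolP[B [l hB]] hw; apply/asboolP.
exists (`|C| * (`|A| + `|B|)), (k + l)%N => n.
apply: (le_trans (hw n)); apply: (@le_trans _ _ (`|C| * (`|u n| + `|v n|))).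
  by rewrite ler_wpM2r ?ler_norm// addr_ge0.
rewrite -mulrA ler_wpM2l// mulrDl.
have n1 : 1 <= n.+1%:R :> R by rewrite ler1n.
rewrite lerD//.
- apply: (le_trans (hA n)); apply: (@le_trans _ _ (`|A| * n.+1%:R ^+ k)).
    by rewrite ler_wpM2r ?ler_norm.
  by rewrite ler_wpM2l// ler_weXn2l// leq_addr.
- apply: (le_trans (hB n)); apply: (@le_trans _ _ (`|B| * n.+1%:R ^+ l)).
    by rewrite ler_wpM2r ?ler_norm.
  by rewrite ler_wpM2l// ler_weXn2l// leq_addl.
Qed.

Lemma tempered_seq_subring_closed : subring_closed (tempered_seq_pred R).
Proof.
split.
- by apply/asboolP; exists 1, 0 => n; rewrite normr1 expr0 mulr1.
- move=> u v hu hv; apply: (tempered_seq_le (C := 1) hu hv) => n.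
  by rewrite mul1r -[leLHS]/(`|u n - v n|) ler_normB.
- move=> u v /asboolP[A [k hA]] /asboolP[B [l hB]]; apply/asboolP.
  exists (A * B), (k + l)%N => n.
  by rewrite -[leLHS]/(`|u n * v n|) normrM exprD mulrACA ler_pM.
Qed.

Lemma rapid_seq_le u v w (C E : R) (k : nat) : u \in rapid_seq_pred R ->
  v \in rapid_seq_pred R ->
  (forall n, `|w n| <= C * n.+1%:R ^+ k * `|u n| + E * `|v n|) ->
  w \in rapid_seq_pred R.
Proof.
move=> /asboolP hu /asboolP hv hw; apply/asboolP => m.
pose U n := (n.+1%:R ^+ (2 * (m + k)) * `|u n| ^+ 2)%:E.
pose V n := (n.+1%:R ^+ (2 * m) * `|v n| ^+ 2)%:E.
have U0 n : (0 <= U n)%E by rewrite lee_fin mulr_ge0.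
have V0 n : (0 <= V n)%E by rewrite lee_fin mulr_ge0.
have C0 : (0 <= (2 * C ^+ 2)%:E)%E by rewrite lee_fin mulr_ge0// sqr_ge0.
have E0 : (0 <= (2 * E ^+ 2)%:E)%E by rewrite lee_fin mulr_ge0// sqr_ge0.
apply: (@le_lt_trans _ _ (\sum_(0 <= n <oo)
    ((2 * C ^+ 2)%:E * U n + (2 * E ^+ 2)%:E * V n))%E); last first.
  rewrite nneseriesD; last 2 first.
  - by move=> n _ _; exact: mule_ge0.
  - by move=> n _ _; exact: mule_ge0.
  rewrite !nneseriesZl//.
  by apply: lte_add_pinfty; apply: lte_mul_pinfty => //; [exact: hu|exact: hv].
apply: lee_nneseries => n; first by rewrite lee_fin mulr_ge0.
move=> _; rewrite -!EFinM -EFinD lee_fin mulnDr exprD.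
set N := n.+1%:R; have N0 : 0 <= N ^+ (2 * m) by rewrite exprn_ge0.
rewrite -subr_ge0 (_ : _ - _ = N ^+ (2 * m) *
    (2 * (C * N ^+ k * `|u n|) ^+ 2 + 2 * (E * `|v n|) ^+ 2 - `|w n| ^+ 2)).
  rewrite mulr_ge0// subr_ge0.
  have := hw n; have := normr_ge0 (w n); rewrite -/N.
  set p := C * _ * _; set q := E * _ => w0 wpq.
  have pq := sqr_ge0 (p - q).
  apply: (@le_trans _ _ ((p + q) ^+ 2)); last by nra.
  by rewrite ler_pXn2r// nnegrE (le_trans w0).
by rewrite !exprMn -exprM [(k * 2)%N]mulnC; ring.
Qed.

Lemma one_notin_rapid_seq : (1 : nat -> R) \notin rapid_seq_pred R.
Proof.
apply/negP => /asboolP /(_ 0); set S := (\sum_(_ <= _ <oo) _)%E => Soo.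
have SN (N : nat) : (N%:R%:E <= S)%E.
  apply: le_trans (nneseries_lim_ge N _); last first.
    by move=> n _; rewrite lee_fin mulr_ge0.
  rewrite (eq_bigr (fun=> 1%:E)); last by move=> i _; rewrite normr1 expr1n mulr1.
  by rewrite sumEFin sumr_const_nat subn0.
have S0 : (0 <= S)%E := SN 0.
have Sf : S \is a fin_num by rewrite ge0_fin_numE.
have := SN (Num.bound (fine S)); rewrite -(fineK Sf) lee_fin leNgt.
by rewrite archi_boundP// fine_ge0.
Qed.

End sequence_closure.

HB.instance Definition _ (R : realType) :=
  GRing.isSubringClosed.Build (nat -> R) (tempered_seq_pred R)
    (@tempered_seq_subring_closed R).

Record tempered_seq (R : realType) := TemperedSeq {
  tempered_seq_fun :> nat -> R;
  tempered_seqP : tempered_seq_fun \in tempered_seq_pred R }.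

HB.instance Definition _ (R : realType) := [isSub for @tempered_seq_fun R].
HB.instance Definition _ (R : realType) := [Choice of tempered_seq R by <:].
HB.instance Definition _ (R : realType) :=
  [SubChoice_isSubComNzRing of tempered_seq R by <:].

Definition rapid_seq (R : realType) : {pred tempered_seq R} :=
  fun a => tempered_seq_fun a \in rapid_seq_pred R.
Arguments rapid_seq R : clear implicits.

Lemma rapid_seq_idealr_closed (R : realType) : idealr_closed (rapid_seq R).
Proof.
have r0 : (0 : nat -> R) \in rapid_seq_pred R.
  apply/asboolP => m; rewrite eseries0 ?ltry// => n _ _.
  by rewrite normr0 expr0n mulr0.
split=> //; first exact: one_notin_rapid_seq.
move=> a u v hu hv; have /asboolP[C [k hC]] := tempered_seqP a.
apply: (rapid_seq_le (C := C) (E := 1) (k := k) hu hv) => n.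
rewrite mul1r -[leLHS]/(`|a n * u n + v n|) (le_trans (ler_normD _ _))// lerD//.
by rewrite normrM ler_wpM2r.
Qed.

HB.instance Definition _ (R : realType) :=
  isIdealr.Build (tempered_seq R) (rapid_seq R) (@rapid_seq_idealr_closed R).

Definition tempered_number (R : realType) : Type := {ideal_quot rapid_seq R}.
HB.instance Definition _ (R : realType) :=
  GRing.ComNzRing.on (tempered_number R).

Definition is_tempered_fseq (R : realType) (f : nat -> schwartz R) : Prop :=
  forall m, (fun n => schwartz_norm m (f n)) \in tempered_seq_pred R.

Definition is_rapid_fseq (R : realType) (f : nat -> schwartz R) : Prop :=
  forall m, (fun n => schwartz_norm m (f n)) \in rapid_seq_pred R.

Section fseq_closure.
Variable R : realType.
Implicit Types f g : nat -> schwartz R.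

Let norm_fseqB f g m n : `|schwartz_norm m ((f - g) n)| <=
  2 * (`|schwartz_norm m (f n)| + `|schwartz_norm m (g n)|).
Proof.
rewrite !(ger0_norm (schwartz_norm_ge0 _ _)).
by rewrite -(schwartz_normN m (g n)); exact: schwartz_normD.
Qed.

Lemma is_tempered_fseq0 : is_tempered_fseq (0 : nat -> schwartz R).
Proof.
move=> m; apply/asboolP; exists 0, 0%N => n.
by rewrite -[X in schwartz_norm _ X]/(0 : schwartz R) schwartz_norm0 normr0 mul0r.
Qed.

Lemma is_tempered_fseqB f g :
  is_tempered_fseq f -> is_tempered_fseq g -> is_tempered_fseq (f - g).
Proof.
by move=> hf hg m; exact: tempered_seq_le (hf m) (hg m) (norm_fseqB f g m).
Qed.

Lemma is_rapid_fseq0 : is_rapid_fseq (0 : nat -> schwartz R).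
Proof.
move=> m; apply/asboolP => k; rewrite eseries0 ?ltry// => n _ _.
rewrite -[X in schwartz_norm _ X]/(0 : schwartz R) schwartz_norm0.
by rewrite normr0 expr0n mulr0.
Qed.

Lemma is_rapid_fseqB f g :
  is_rapid_fseq f -> is_rapid_fseq g -> is_rapid_fseq (f - g).
Proof.
move=> hf hg m.
apply: (rapid_seq_le (C := 2) (E := 2) (k := 0) (hf m) (hg m)) => n.
by rewrite expr0 mulr1 -mulrDr; exact: norm_fseqB.
Qed.

End fseq_closure.

Definition tempered_fseq_pred (R : realType) : {pred nat -> schwartz R} :=
  fun f => `[< is_tempered_fseq f >].
Arguments tempered_fseq_pred R : clear implicits.

Lemma tempered_fseq_zmod_closed (R : realType) :
  zmod_closed (tempered_fseq_pred R).
Proof.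
split=> [|f g /asboolP hf /asboolP hg]; apply/asboolP.
  exact: is_tempered_fseq0.
exact: is_tempered_fseqB.
Qed.

HB.instance Definition _ (R : realType) :=
  GRing.isZmodClosed.Build (nat -> schwartz R) (tempered_fseq_pred R)
    (@tempered_fseq_zmod_closed R).

Record tempered_fseq (R : realType) := TemperedFseq {
  tempered_fseq_fun :> nat -> schwartz R;
  tempered_fseqP : tempered_fseq_fun \in tempered_fseq_pred R }.

HB.instance Definition _ (R : realType) := [isSub for @tempered_fseq_fun R].
HB.instance Definition _ (R : realType) := [Choice of tempered_fseq R by <:].
HB.instance Definition _ (R : realType) :=
  [SubChoice_isSubZmodule of tempered_fseq R by <:].

Definition rapid_fseq (R : realType) : {pred tempered_fseq R} :=
  fun f => `[< is_rapid_fseq f >].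
Arguments rapid_fseq R : clear implicits.

Lemma rapid_fseq_zmod_closed (R : realType) : zmod_closed (rapid_fseq R).
Proof.
split=> [|f g /asboolP hf /asboolP hg]; apply/asboolP.
  exact: is_rapid_fseq0.
exact: (is_rapid_fseqB hf hg).
Qed.

HB.instance Definition _ (R : realType) :=
  GRing.isZmodClosed.Build (tempered_fseq R) (rapid_fseq R)
    (@rapid_fseq_zmod_closed R).

Definition tempered_genfun (R : realType) : Type := Quotient.quot (rapid_fseq R).
HB.instance Definition _ (R : realType) := GRing.Zmodule.on (tempered_genfun R).

Local Open Scope quotient_scope.

Section tempered_calculus.
Variable R : realType.
Implicit Types (a : tempered_number R) (F G : tempered_genfun R).

(* [num_class b] and [fun_class f] are the classes [b_n] and [f_n]. They are   *)
(* made total by sending the sequences that do not represent anything, i.e.,  *)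
(* those outside s' and H_s', to 0. Operations on classes are applied to the  *)
(* canonical representatives chosen by [repr]. Since s' and H_s' are stable   *)
(* under the termwise operations below and s and H_s absorb them, neither     *)
(* this default value nor the choice of the representatives matters.          *)
Definition num_class (b : nat -> R) : tempered_number R :=
  \pi_({ideal_quot rapid_seq R}) (insubd (0 : tempered_seq R) b).

Definition fun_class (f : nat -> schwartz R) : tempered_genfun R :=
  \pi_(Quotient.quot (rapid_fseq R)) (insubd (0 : tempered_fseq R) f).

Definition num_repr a : nat -> R :=
  tempered_seq_fun (repr (a : {ideal_quot rapid_seq R})).

Definition fun_repr F : nat -> schwartz R :=
  tempered_fseq_fun (repr (F : Quotient.quot (rapid_fseq R))).

Lemma num_class_eq (b c : nat -> R) : b \in tempered_seq_pred R ->
  c \in tempered_seq_pred R ->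
  num_class b = num_class c <-> b - c \in rapid_seq_pred R.
Proof.
move=> hb hc; rewrite /num_class; set x := insubd _ b; set y := insubd _ c.
have -> : b - c = tempered_seq_fun (x - y).
  by rewrite -[in LHS](insubdK (0 : tempered_seq R) hb)
             -[in LHS](insubdK (0 : tempered_seq R) hc).
split=> [/eqP|h]; first by rewrite -Quotient.idealrBE.
by apply/eqP; rewrite -Quotient.idealrBE.
Qed.

Lemma num_classK a : num_class (num_repr a) = a.
Proof. by rewrite /num_class /num_repr valKd reprK. Qed.

Lemma fun_class_eq (f g : nat -> schwartz R) : is_tempered_fseq f ->
  is_tempered_fseq g -> fun_class f = fun_class g <-> is_rapid_fseq (f - g).
Proof.
move=> /asboolP hf /asboolP hg.
rewrite /fun_class; set x := insubd _ f; set y := insubd _ g.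
have -> : f - g = tempered_fseq_fun (x - y).
  by rewrite -[in LHS](insubdK (0 : tempered_fseq R) hf)
             -[in LHS](insubdK (0 : tempered_fseq R) hg).
split=> [/eqP|h]; first by rewrite -Quotient.idealrBE => /asboolP.
by apply/eqP; rewrite -Quotient.idealrBE; exact/asboolP.
Qed.

Lemma fun_classK F : fun_class (fun_repr F) = F.
Proof. by rewrite /fun_class /fun_repr valKd reprK. Qed.

Definition genfun_mul F G : tempered_genfun R :=
  fun_class (fun n => schwartzM (fun_repr F n) (fun_repr G n)).

Definition genfun_scale a F : tempered_genfun R :=
  fun_class (fun n => num_repr a n *: fun_repr F n).

Definition genfun_deriv F : tempered_genfun R :=
  fun_class (fun n => schwartz_deriv (fun_repr F n)).

(* Lebesgue, not only Borel, measurability: the domain of [completed_lebesgue_measure] *)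
Definition lebesgue_measurable (A : set R) : Prop :=
  ((@wlength R idfun)^*%mu.-cara.-measurable) A.

Definition lebesgue_int (A : set R) (f : R -> R) : R :=
  Rintegral (@completed_lebesgue_measure R) A f.

Definition genfun_integral (A : set R) F : tempered_number R :=
  num_class (fun n => lebesgue_int A (fun_repr F n)).

Definition num_iota (c : R) : tempered_number R := num_class (fun=> c).

(* continuity is for the locally convex topology given by the norms *)
Definition tempered_distribution (T : schwartz R -> R) : Prop :=
  scalar T /\
  forall (f : schwartz R) (e : R), 0 < e -> exists (m : nat) (d : R), 0 < d /\
    forall g : schwartz R,
      (forall k, (k <= m)%N -> schwartz_norm k (g - f) < d) ->
      `|T g - T f| < e.

Definition distribution_iota (T : schwartz R -> R) : tempered_genfun R :=
  fun_class (fun n => \sum_(j < n.+1) T (hermite R j) *: hermite R j).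

Definition schwartz_distribution (f : schwartz R) : schwartz R -> R :=
  fun g => lebesgue_int setT (fun x => f x * g x).

Definition schwartz_iota (f : schwartz R) : tempered_genfun R :=
  distribution_iota (schwartz_distribution f).

End tempered_calculus.

(* Main.v *)
Require Import Defs.
From HB Require Import structures.
From mathcomp Require Import all_boot all_order all_algebra.
From mathcomp Require Import all_classical all_reals all_analysis.
From mathcomp Require Import measurable_realfun ring lra.
Import Order.TTheory GRing.Theory Num.Theory.
Import numFieldNormedType.Exports.
Local Open Scope ring_scope.
Local Open Scope classical_set_scope.
Set Implicit Arguments.
Unset Strict Implicit.
Unset Printing Implicit Defensive.

(** Tempered numbers and tempered generalized functions are classes of sequences,
    so each rule is proved on representatives, once the operations are known to
    respect the classes. This follows from three estimates by the Schwartz norms: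
    [|\int_A f| <= C |f|_3] uniformly in [A] ([lebesgue_int_dominated]),
    [|f'|_m <= C |f|_(m+1)] ([schwartz_norm_deriv]) and
    [|f g|_m <= C |f|_k |g|_k] ([schwartz_normM]). Rules (a) and (b) are then
    those of the Lebesgue integral, and (d) is integration by parts for Schwartz
    functions, one derivative at a time.

    Rules (c) and (e) rest on the fact that a Schwartz function [phi] differs
    from its Hermite sums [phi_n] by an element of [H_s], so that [iota phi] is
    the class of the constant sequence [phi] ([schwartz_iotaE]). This is (c); for
    (e), the integral of [T_n phi] is [T phi_n], and [T (phi - phi_n)] is bounded
    by a Schwartz norm of [phi - phi_n].

    The Hermite functions of weight [exp (- x^2 / 4)] are not eigenfunctions
    of [N + 1] but of [M = - D^2 + X^2 / 4 + 1 / 2]. This is harmless: since the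
    commutators of an operator [- a D^2 + b X^2 + c] with [X] and [D] are
    multiples of [D] and [X], all such operators with positive coefficients yield
    equivalent families of norms ([osc_norm_compare]).

    For [M] the remainders [r_n = phi - phi_n] are estimated through a spectral
    gap: if [psi] is orthogonal to the first [n] Hermite functions, then
    [(n + 1) |psi| <= |M psi|] ([osc_gap]). The proof is algebraic, by induction
    on [n] with the ladder operators. Its only analytic input is that a Schwartz
    function orthogonal to the ground state is the image of a Schwartz function
    under the creation operator ([raise_surjective]), which is shown by solving a
    linear first-order equation. Iterating the gap bounds
    [(n + 1)^k |M^m r_n|] by [|M^(k + m) phi|] ([hermite_rem_decay]), which is
    rapid decay in every norm and contains the completeness of the Hermite
    functions. *)

(** * Lebesgue integrals and Schwartz functions *)

Section lebesgue_integrals.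
Variable R : realType.
Local Notation mu := (@lebesgue_measure R).
Local Notation cmu := (@completed_lebesgue_measure R).

(** The completed measure is defined on a larger sigma-algebra than Lebesgue
    measure; its push-forward by the identity is Lebesgue measure, which is how
    integrals over the two measures are compared. *)
Lemma measurable_id_completed :
  measurable_fun setT (id : caratheodory_type ((@wlength R idfun)^*)%mu -> measurableTypeR R).
Proof.
move=> _ B mB; rewrite setTI preimage_id; exact: sub_caratheodory.
Qed.

Lemma ge0_integral_completed (f : R -> \bar R) :
  measurable_fun setT (f : measurableTypeR R -> \bar R) -> (forall x, 0 <= f x)%E ->
  (\int[cmu]_x f x = \int[mu]_x f x)%E.
Proof.
move=> mf f0.
have := @ge0_integral_pushforward _ _ _ _ R _ measurable_id_completed cmu setT f.
move=> /(_ measurableT mf (fun x _ => f0 x)) => h.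
rewrite -[LHS]h.
by [].
Qed.

Lemma integrable_oneDsqrV : mu.-integrable setT (EFin \o (fun x : R => (oneDsqr x)^-1)).
Proof.
have c1 : continuous (fun x : R => (oneDsqr x)^-1) by exact: continuous_oneDsqrV.
apply/integrableP; split.
  by apply/measurable_EFinP; exact: continuous_measurable_fun.
under eq_integral do rewrite gee0_abs ?lee_fin ?invr_ge0//.
rewrite ge0_symfun_integralT//=; last first.
  by move=> x; rewrite /= /oneDsqr sqrrN.
rewrite (_ : [set x | _] = `[0, +oo[%classic); last first.
  by apply/seteqP; split=> x /=; rewrite in_itv/= andbT.
by rewrite integral0y_oneDsqr lte_mul_pinfty ?ltry ?lee_fin.
Qed.

End lebesgue_integrals.

Section schwartz_basic.
Variable R : realType.
Implicit Types (f g w : schwartz R) (c x : R).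
Local Notation mu := (@lebesgue_measure R).
Local Notation cmu := (@completed_lebesgue_measure R).
Local Notation D := (@schwartz_deriv R).
Local Notation X := (@schwartz_mulX R).

Lemma schwartz_ext f g : (forall x, f x = g x) -> f = g.
Proof. by move=> fg; apply: val_inj; apply/funext => x; exact: fg. Qed.

Lemma schwartzDE f g x : (f + g) x = f x + g x. Proof. by []. Qed.
Lemma schwartzNE f x : (- f) x = - f x. Proof. by []. Qed.
Lemma schwartzZE c f x : (c *: f) x = c * f x. Proof. by []. Qed.
Lemma schwartz0E x : (0 : schwartz R) x = 0. Proof. by []. Qed.
Lemma schwartzME f g x : schwartzM f g x = f x * g x. Proof. by []. Qed.
Lemma schwartz_mulXE f x : X f x = x * f x. Proof. by []. Qed.
Definition schwartzE := (schwartzDE, schwartzNE, schwartzZE, schwartz0E, schwartzME, schwartz_mulXE).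

Lemma schwartz_is_derive f x : is_derive x 1 (f : R -> R) (D f x).
Proof.
apply: DeriveDef; first exact: is_schwartz_derivable (schwartz_is_schwartz f).
by rewrite /= derive1E.
Qed.

Lemma schwartz_continuous f : continuous (f : R -> R).
Proof.
move=> x; apply/differentiable_continuous/derivable1_diffP.
exact: is_schwartz_derivable (schwartz_is_schwartz f).
Qed.

Lemma schwartz_deriv_is_linear : linear (D : schwartz R -> schwartz R).
Proof.
move=> c f g; apply: val_inj.
have sf := schwartz_is_schwartz f; have sg := schwartz_is_schwartz g.
by rewrite /= derive1_fctD ?derive1_fctZ//; exact: is_schwartzZ.
Qed.
HB.instance Definition _ := GRing.isLinear.Build R (schwartz R) (schwartz R) _ D
  schwartz_deriv_is_linear.

Lemma schwartz_mulX_is_linear : linear (X : schwartz R -> schwartz R).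
Proof. by move=> c f g; apply: schwartz_ext => x; rewrite !schwartzE; ring. Qed.
HB.instance Definition _ := GRing.isLinear.Build R (schwartz R) (schwartz R) _ X
  schwartz_mulX_is_linear.

Lemma derivM f g : D (schwartzM f g) = schwartzM (D f) g + schwartzM f (D g).
Proof.
by apply: val_inj; rewrite /= derive1_fctM//; exact: schwartz_is_schwartz.
Qed.

Lemma derivX f : D (X f) = f + X (D f).
Proof.
apply: schwartz_ext => x.
have h1 := schwartz_is_derive f x.
have h2 : is_derive x 1 (X f : R -> R) (f x + x * D f x).
  rewrite (_ : (X f : R -> R) = id * (f : R -> R))//.
  apply: (is_derive_eq (is_deriveM (is_derive_id x 1) h1)).
  by rewrite /GRing.scale/= mulr1 addrC.
by case: (schwartz_is_derive (X f) x) => _ <-; case: h2.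
Qed.

(** Integrability, with respect to both measures, comes from comparison with the
    integrable function [1 / (1 + x^2)]. *)
Lemma schwartz_dominated f : exists K, forall x, `|f x| <= K * (oneDsqr x)^-1.
Proof.
have [C hC] := is_schwartz_rapid (schwartz_is_schwartz f) 0.
have [E hE] := is_schwartz_rapid (schwartz_is_schwartz f) 2.
exists (C + E) => x.
have d0 : 0 < oneDsqr x :> R by rewrite /oneDsqr ltr_pwDl// sqr_ge0.
rewrite ler_pdivlMr// /oneDsqr mulrDr mulr1 lerD//.
  by have := hC x; rewrite expr0 mul1r.
by have := hE x; rewrite normrM [`|x ^+ 2|]ger0_norm ?sqr_ge0// mulrC.
Qed.

Lemma measurable_schwartz f : measurable_fun setT (f : measurableTypeR R -> R).
Proof. by apply: continuous_measurable_fun; exact: schwartz_continuous. Qed.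

Lemma schwartz_integrable f : mu.-integrable setT (EFin \o f).
Proof.
have [K hK] := schwartz_dominated f.
apply: (le_integrable measurableT _ _ (integrableZl measurableT K (integrable_oneDsqrV R))).
  by apply/measurable_EFinP; exact: measurable_schwartz.
by move=> x _; rewrite /= lee_fin (le_trans (hK x))// ler_norm.
Qed.

Lemma schwartz_integrable_norm f : mu.-integrable setT (EFin \o (fun x => `|f x|)).
Proof. exact: (integrable_norm (schwartz_integrable f)). Qed.

Lemma schwartz_integrable_sub f (A : set (measurableTypeR R)) :
  measurable A -> mu.-integrable A (EFin \o f).
Proof. by move=> mA; apply: integrableS (schwartz_integrable f). Qed.

Lemma schwartz_integrable_completed f : cmu.-integrable setT (EFin \o f).
Proof.
have mf := measurable_schwartz f.
apply/integrableP; split.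
  apply/measurable_EFinP => _ B mB; rewrite setTI.
  by apply: sub_caratheodory; rewrite -[X in measurable X]setTI; exact: mf.
rewrite ge0_integral_completed//.
  by have /integrableP[] := schwartz_integrable f.
by apply: measurableT_comp => //; apply/measurable_EFinP.
Qed.

Lemma Rintegral_completed f : Rintegral cmu setT f = Rintegral mu setT f.
Proof.
rewrite /Rintegral; congr fine; rewrite integralE [RHS]integralE.
have mf : measurable_fun setT (EFin \o f : measurableTypeR R -> \bar R).
  by apply/measurable_EFinP; exact: measurable_schwartz.
rewrite !ge0_integral_completed//.
- exact: measurable_funeneg.
- exact: measurable_funepos.
Qed.

End schwartz_basic.

(** * Integrals and primitives of Schwartz functions *)

Section schwartz_integral.
Variable R : realType.
Implicit Types (f g w : schwartz R) (c x : R).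
Local Notation mu := (@lebesgue_measure R).
Local Notation cmu := (@completed_lebesgue_measure R).
Local Notation D := (@schwartz_deriv R).
Local Notation X := (@schwartz_mulX R).

Definition schwartz_int f : R := \int[mu]_(x in setT) f x.

Lemma lebesgue_int_setT f : lebesgue_int setT f = schwartz_int f.
Proof. exact: Rintegral_completed. Qed.

Lemma lebesgue_int_linear (A : set R) c f g : lebesgue_measurable A ->
  lebesgue_int A (c *: f + g) = c * lebesgue_int A f + lebesgue_int A g.
Proof.
move=> mA; have i h : cmu.-integrable A (EFin \o (h : schwartz R)).
  exact: integrableS (schwartz_integrable_completed h).
rewrite /lebesgue_int -(RintegralZl c mA (i f)).
exact: (RintegralD mA (i (c *: f)) (i g)).
Qed.

Lemma schwartz_int_is_linear : scalar schwartz_int.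
Proof.
by move=> c f g; rewrite -!lebesgue_int_setT; apply: lebesgue_int_linear; exact: measurableT.
Qed.
HB.instance Definition _ := GRing.isLinear.Build R (schwartz R) R _ schwartz_int
  schwartz_int_is_linear.

Lemma lebesgue_int_setU (A B : set R) f : lebesgue_measurable A ->
  lebesgue_measurable B -> A `&` B = set0 ->
  lebesgue_int (A `|` B) f = lebesgue_int A f + lebesgue_int B f.
Proof.
move=> mA mB AB; rewrite /lebesgue_int Rintegral_setU//.
  by apply: integrableS (schwartz_integrable_completed f) => //; exact: measurableU.
by apply/eqP; rewrite AB.
Qed.

(** The bound has to be uniform in [A]: it is obtained by enlarging [A] to the
    whole line, where the completed measure gives the same integral as Lebesgue
    measure. *)
Lemma le_lebesgue_int (A : set R) f K : lebesgue_measurable A ->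
  (forall x, `|f x| <= K * (oneDsqr x)^-1) ->
  `|lebesgue_int A f| <= K * \int[mu]_(x in setT) (oneDsqr x)^-1.
Proof.
move=> mA fK.
have i := schwartz_integrable_completed f.
have iA : cmu.-integrable A (EFin \o f) by exact: integrableS i.
have iK := integrableZl measurableT K (integrable_oneDsqrV R).
apply: (le_trans (le_normr_Rintegral mA iA)).
apply: (@le_trans _ _ (\int[mu]_(x in setT) `|f x|)).
  have m1 : measurable_fun setT (EFin \o (fun x => `|f x|) : measurableTypeR R -> \bar R).
    by have /integrableP[] := schwartz_integrable_norm f.
  rewrite /Rintegral -ge0_integral_completed//.
  apply: fine_le.
  - by apply: integrable_fin_num => //; exact: (integrable_norm iA).
  - by apply: integrable_fin_num => //; exact: (integrable_norm i).
  have /integrableP[mf _] := integrable_norm i.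
  have h0 : forall x, setT x -> (0 <= (`|f x|%:E))%E by [].
  have h := @ge0_subset_integral _ _ _ cmu A setT mA measurableT
    (fun x => `|f x|%:E) mf h0 (@subsetT _ A).
  by apply: h.
rewrite -RintegralZl//; last exact: integrable_oneDsqrV.
by apply: le_Rintegral => //; exact: schwartz_integrable_norm.
Qed.

Lemma schwartz_int_ge0 f : (forall x, 0 <= f x) -> 0 <= schwartz_int f.
Proof. by move=> f0; apply: Rintegral_ge0. Qed.

Definition schwartz_prim f x : R := \int[mu]_(t in `]-oo, x]) f t.

Lemma schwartz_prim_is_derive f x : is_derive x 1 (schwartz_prim f) (f x).
Proof.
have xx1 : x < x + 1 by rewrite ltrDl.
have ix : mu.-integrable [set` Interval -oo%O (BRight (x + 1))] (EFin \o f).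
  exact: schwartz_integrable_sub.
have := @continuous_FTC1 R f -oo%O x (x + 1) xx1 ix.
rewrite ltNyr => /(_ isT (@schwartz_continuous R f x))[d <-];  rewrite derive1E; exact: DeriveDef.
Qed.

Lemma schwartz_prim_tail f x :
  schwartz_int f - schwartz_prim f x = \int[mu]_(t in `]x, +oo[) f t.
Proof.
apply/eqP; rewrite subr_eq addrC; apply/eqP.
rewrite /schwartz_int /schwartz_prim -Rintegral_setU//=.
- rewrite (_ : _ `|` _ = setT)//; apply/seteqP; split=> // t _ /=.
  by rewrite !in_itv/= andbT leNgt; apply/orP; rewrite orNb.
- by apply: schwartz_integrable_sub; exact: measurableU.
- apply/disj_setPS => t /= []; rewrite !in_itv/= andbT => tx xt.
  by have := lt_le_trans xt tx; rewrite ltxx.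
Qed.

(** Used with [c] a power of an endpoint of [A]: a factor depending on the
    endpoint is moved under the integral, where it is absorbed by the decay
    of [f]. *)
Lemma le_Rintegral_weight (A : set (measurableTypeR R)) c f w : measurable A ->
  (forall t, A t -> `|c * f t| <= `|w t|) ->
  `|c * \int[mu]_(t in A) f t| <= \int[mu]_(t in setT) `|w t|.
Proof.
move=> mA fw; have iA := schwartz_integrable_sub f mA.
rewrite -RintegralZl//.
have icA : mu.-integrable A (EFin \o (fun t => c * f t)) by exact: (integrableZl mA c iA).
have iw := schwartz_integrable_norm w.
have iwA : mu.-integrable A (EFin \o (fun t => `|w t|)) by exact: integrableS iw.
apply: (le_trans (le_normr_Rintegral mA icA)).
apply: (@le_trans _ _ (\int[mu]_(t in A) `|w t|)).
  by apply: le_Rintegral => //; exact: (integrable_norm icA).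
apply: fine_le; rewrite ?integrable_fin_num//.
have /integrableP[mf _] := iw.
have h0 : forall x, setT x -> (0 <= (`|w x|%:E))%E by [].
have h := @ge0_subset_integral _ _ _ mu A setT mA measurableT
  (fun x => `|w x|%:E) mf h0 (@subsetT _ A).
by apply: h.
Qed.

(** These two bounds give the decay of a primitive at the two ends of the line. *)
Lemma schwartz_prim_left f x c w :
  (forall t, t <= x -> `|c * f t| <= `|w t|) ->
  `|c * schwartz_prim f x| <= \int[mu]_(t in setT) `|w t|.
Proof. by move=> h; apply: le_Rintegral_weight => // t; rewrite /= in_itv/=; exact: h. Qed.

Lemma schwartz_prim_right f x c w :
  (forall t, x <= t -> `|c * f t| <= `|w t|) ->
  `|c * (schwartz_int f - schwartz_prim f x)| <= \int[mu]_(t in setT) `|w t|.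
Proof.
move=> h; rewrite schwartz_prim_tail; apply: le_Rintegral_weight => // t.
by rewrite /= in_itv/= andbT => /ltW; exact: h.
Qed.

(** A constant that is [O(1/x)] vanishes. This replaces passing to the limit at
    infinity in the two lemmas below. *)
Lemma bounded_mul_eq0 (u K : R) :
  (forall x, 1 <= x -> `|x * u| <= K) -> u = 0.
Proof.
move=> h; apply/eqP/negPn/negP => u0.
have K0 : 0 <= K by rewrite (le_trans _ (h 1 _)).
have un : 0 < `|u| by rewrite normr_gt0.
have := h ((K + 1) / `|u| + 1); rewrite lerDr divr_ge0 ?addr_ge0// => /(_ isT).
rewrite normrM ger0_norm; last by rewrite addr_ge0// divr_ge0// addr_ge0.
rewrite mulrDl mulfVK ?gt_eqF// => {}h.
by have := normr_ge0 u; lra.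
Qed.

(** The difference of the two sides is constant, because the derivatives agree,
    and it is [O(1/x)] at minus infinity. *)
Lemma schwartz_prim_deriv f x : schwartz_prim (D f) x = f x.
Proof.
have hc y : schwartz_prim (D f) y - f y = schwartz_prim (D f) 0 - f 0.
  apply: (@is_derive_0_is_cst _ (fun y => schwartz_prim (D f) y - f y)) => z.
  have := is_deriveB (schwartz_prim_is_derive (D f) z) (schwartz_is_derive f z).
  by rewrite subrr.
apply/eqP; rewrite -subr_eq0 hc; apply/eqP.
have [C hC] := is_schwartz_rapid (schwartz_is_schwartz f) 1.
apply: (bounded_mul_eq0 (K := \int[mu]_(t in setT) `|X (D f) t| + C)) => y y1.
rewrite -(hc (- y)) mulrBr (le_trans (ler_normB _ _))// lerD//.
  apply: schwartz_prim_left => t ty; rewrite schwartz_mulXE !normrM.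
  by rewrite ler_wpM2r// (@ger0_norm _ y) ?(@ler0_norm _ t); lra.
by have := hC (- y); rewrite expr1 mulNr normrN.
Qed.

(** This is what integration by parts on the whole line amounts to, since
    boundary terms at infinity vanish. *)
Lemma schwartz_int_deriv f : schwartz_int (D f) = 0.
Proof.
have [C hC] := is_schwartz_rapid (schwartz_is_schwartz f) 1.
apply: (bounded_mul_eq0 (K := \int[mu]_(t in setT) `|X (D f) t| + C)) => y y1.
have -> : schwartz_int (D f) = (schwartz_int (D f) - schwartz_prim (D f) y) + f y.
  by rewrite schwartz_prim_deriv subrK.
rewrite mulrDr (le_trans (ler_normD _ _))// lerD//; last by have := hC y.
apply: schwartz_prim_right => t ty; rewrite schwartz_mulXE !normrM.
by rewrite ler_wpM2r// !ger0_norm; lra.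
Qed.

End schwartz_integral.

(** * Domination and the scalar product of Schwartz functions *)

Section domination.
Variables (R : realType) (T : Type).
Implicit Types p q r : T -> R.

(** Estimates up to an unspecified constant. [T] is a type of functions, or of
    pairs of functions for the estimate of products. *)
Definition dominated p q := exists2 C : R, 0 <= C & forall t, p t <= C * q t.

Lemma dominated_le p q : (forall t, p t <= q t) -> dominated p q.
Proof. by move=> pq; exists 1 => // t; rewrite mul1r. Qed.

Lemma dominated_trans q p r : dominated p q -> dominated q r -> dominated p r.
Proof.
move=> [C C0 pq] [E E0 qr]; exists (C * E) => [|t]; first exact: mulr_ge0.
by rewrite (le_trans (pq t))// -mulrA ler_wpM2l.
Qed.

Lemma dominatedD p q r : dominated p r -> dominated q r ->
  dominated (fun t => p t + q t) r.
Proof.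
move=> [C C0 pr] [E E0 qr]; exists (C + E) => [|t]; first exact: addr_ge0.
by rewrite mulrDl lerD.
Qed.

Lemma dominatedZ c p q : 0 <= c -> dominated p q -> dominated (fun t => c * p t) q.
Proof.
move=> c0 [C C0 pq]; exists (c * C) => [|t]; first exact: mulr_ge0.
by rewrite -mulrA ler_wpM2l.
Qed.

End domination.

Section inner_product.
Variable R : realType.
Implicit Types (f g w : schwartz R) (c x : R).
Local Notation D := (@schwartz_deriv R).
Local Notation X := (@schwartz_mulX R).

Definition ip f g : R := schwartz_int (schwartzM f g).
Definition l2norm f : R := Num.sqrt (ip f f).

Lemma ipC f g : ip f g = ip g f.
Proof. by congr schwartz_int; apply: schwartz_ext => x; rewrite !schwartzE mulrC. Qed.

Lemma ip_is_linear f : scalar (ip f).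
Proof.
move=> c g h; rewrite /ip -[RHS](linearP (@schwartz_int R)); congr schwartz_int.
by apply: schwartz_ext => x; rewrite !schwartzE; ring.
Qed.
HB.instance Definition _ f := GRing.isLinear.Build R (schwartz R) R _ (ip f)
  (ip_is_linear f).

Lemma ipDl f g h : ip (f + g) h = ip f h + ip g h.
Proof. by rewrite ipC linearD/= !(ipC h). Qed.
Lemma ipZl c f h : ip (c *: f) h = c * ip f h.
Proof. by rewrite ipC linearZ/= (ipC h). Qed.
Lemma ipNl f h : ip (- f) h = - ip f h.
Proof. by rewrite ipC linearN/= (ipC h). Qed.
Lemma ipDr f g h : ip h (f + g) = ip h f + ip h g. Proof. exact: linearD. Qed.
Lemma ipZr c f h : ip h (c *: f) = c * ip h f. Proof. exact: linearZ. Qed.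
Lemma ipNr f h : ip h (- f) = - ip h f. Proof. exact: linearN. Qed.
Definition ipE := (ipDl, ipNl, ipZl, ipDr, ipNr, ipZr).

Lemma ip_ge0 f : 0 <= ip f f.
Proof. by apply: schwartz_int_ge0 => x; rewrite schwartzE -expr2 sqr_ge0. Qed.

Lemma ip_mulX f g : ip (X f) g = ip f (X g).
Proof. by congr schwartz_int; apply: schwartz_ext => x; rewrite !schwartzE; ring. Qed.

Lemma ip_deriv f g : ip (D f) g = - ip f (D g).
Proof.
apply/eqP; rewrite -addr_eq0 /ip -linearD/= -derivM; apply/eqP.
exact: schwartz_int_deriv.
Qed.

Lemma l2norm_ge0 f : 0 <= l2norm f. Proof. exact: sqrtr_ge0. Qed.
Lemma l2norm_sqr f : l2norm f ^+ 2 = ip f f. Proof. exact/sqr_sqrtr/ip_ge0. Qed.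

(** The discriminant of the nonnegative quadratic form [|t f - g|^2] in [t]. *)
Lemma CauchySchwarz f g : `|ip f g| <= l2norm f * l2norm g.
Proof.
have h t : 0 <= t ^+ 2 * ip f f - 2 * t * ip f g + ip g g.
  rewrite (_ : _ + _ = ip (t *: f - g) (t *: f - g)) ?ip_ge0//.
  by rewrite !ipE (ipC g f); ring.
rewrite -ler_sqr ?nnegrE ?mulr_ge0 ?l2norm_ge0// exprMn !l2norm_sqr real_normK ?num_real//.
have := ip_ge0 f; rewrite le_eqVlt => /orP[/eqP f0|f0].
  rewrite -f0 mul0r.
  have [->|fg0] := eqVneq (ip f g) 0; first by rewrite expr0n.
  have := h ((ip g g + 1) / (2 * ip f g)); rewrite -f0 mulr0 add0r.
  have -> : 2 * ((ip g g + 1) / (2 * ip f g)) * ip f g = ip g g + 1 by field.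
  by lra.
have := h (ip f g / ip f f).
have -> : (ip f g / ip f f) ^+ 2 * ip f f - 2 * (ip f g / ip f f) * ip f g + ip g g
   = (ip f f * ip g g - ip f g ^+ 2) / ip f f by field; rewrite gt_eqF.
by rewrite pmulr_lge0 ?invr_gt0// subr_ge0.
Qed.

Lemma l2normD f g : l2norm (f + g) <= l2norm f + l2norm g.
Proof.
rewrite -ler_sqr ?nnegrE ?addr_ge0 ?l2norm_ge0// sqrrD !l2norm_sqr !ipE (ipC g f).
have := CauchySchwarz f g; have := ler_norm (ip f g); lra.
Qed.

Lemma l2normZ c f : l2norm (c *: f) = `|c| * l2norm f.
Proof. by rewrite /l2norm !ipE mulrA -expr2 sqrtrM ?sqr_ge0// sqrtr_sqr. Qed.

Lemma schwartz_normE m f : schwartz_norm m f = l2norm (iter m (@numberop1 R) f).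
Proof.
rewrite /schwartz_norm /l2norm; congr Num.sqrt; apply: eq_Rintegral => x _.
by rewrite real_normK ?num_real// schwartzME expr2.
Qed.

End inner_product.

(** * Norms given by a harmonic oscillator *)

Section oscillator.
Variable R : realType.
Implicit Types (f g w : schwartz R) (c x : R).
Local Notation D := (@schwartz_deriv R).
Local Notation X := (@schwartz_mulX R).

(** The operator [- a D^2 + b X^2 + c]. Both [N + 1] and the operator that is
    diagonal in the Hermite functions are of this form, with different
    coefficients. *)
Definition osc (a b c : R) f : schwartz R :=
  - a *: D (D f) + b *: X (X f) + c *: f.

Lemma osc_is_linear a b c : linear (osc a b c).
Proof.
move=> k f g; rewrite /osc !linearP.
apply: schwartz_ext => x; rewrite !schwartzE.
by move: (D (D f) x) (D (D g) x) (f x) (g x) => p q r s; ring.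
Qed.
HB.instance Definition _ a b c := GRing.isLinear.Build R (schwartz R) (schwartz R) _
  (osc a b c) (osc_is_linear a b c).

Lemma numberop1E f : numberop1 f = osc 2^-1 2^-1 2^-1 f.
Proof.
by rewrite /numberop1 /osc; apply: schwartz_ext => x; rewrite !schwartzE; ring.
Qed.

(** The commutators [[osc, X]] and [[osc, D]] are multiples of [D] and [X]. This
    is why [X] and [D] lose only one power of the oscillator, see
    [osc_norm_XD]. *)
Lemma oscX a b c f : osc a b c (X f) = X (osc a b c f) + (- 2 * a) *: D f.
Proof.
rewrite /osc derivX linearD/= derivX; apply: schwartz_ext => x.
by rewrite !schwartzE; ring.
Qed.

Lemma oscD a b c f : osc a b c (D f) = D (osc a b c f) + (- 2 * b) *: X f.
Proof.
rewrite /osc !linearD/= !linearZ/= derivX linearD/= derivX; apply: schwartz_ext => x.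
by rewrite !schwartzE; ring.
Qed.

Definition osc_norm a b c m f : R := l2norm (iter m (osc a b c) f).

Lemma osc_normD a b c m f g :
  osc_norm a b c m (f + g) <= osc_norm a b c m f + osc_norm a b c m g.
Proof.
rewrite /osc_norm (_ : iter m _ _ = iter m (osc a b c) f + iter m (osc a b c) g) ?l2normD//.
by elim: m => //= m ->; rewrite linearD.
Qed.

Lemma osc_normZ a b c m k f : osc_norm a b c m (k *: f) = `|k| * osc_norm a b c m f.
Proof.
rewrite /osc_norm -l2normZ; congr l2norm.
by elim: m => //= m ->; rewrite linearZ.
Qed.

(** Coercivity: with positive coefficients each of the three terms is bounded by
    [ip f (osc a b c f)], hence by [|f| |osc a b c f|]. *)
Lemma ip_osc a b c f :
  ip f (osc a b c f) = a * ip (D f) (D f) + b * ip (X f) (X f) + c * ip f f.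
Proof.
rewrite /osc !ipE (ipC f (D (D f))) ip_deriv (ipC f (X (X f))) ip_mulX.
by ring.
Qed.

Section positive.
Variables (a b c : R).
Hypotheses (a0 : 0 < a) (b0 : 0 < b) (c0 : 0 < c).
Local Notation N := (osc_norm a b c).

Lemma osc_norm0_le : dominated (N 0) (N 1).
Proof.
exists c^-1; rewrite ?invr_ge0 ?ltW// => f; rewrite /osc_norm/=.
have [->|f0] := eqVneq (l2norm f) 0; first by rewrite mulr_ge0 ?invr_ge0 ?l2norm_ge0// ltW.
have fp : 0 < l2norm f by rewrite lt_def f0 l2norm_ge0.
rewrite ler_pdivlMl// -(ler_pM2l fp).
apply: le_trans (le_trans (ler_norm _) (CauchySchwarz f (osc a b c f))).
have := mulr_ge0 (ltW a0) (ip_ge0 (D f)); have := mulr_ge0 (ltW b0) (ip_ge0 (X f)).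
by rewrite ip_osc mulrCA -expr2 l2norm_sqr; lra.
Qed.

Lemma sqr_dominated0 (L : schwartz R -> schwartz R) e : 0 < e ->
  (forall f, e * ip (L f) (L f) <= ip f (osc a b c f)) ->
  dominated (fun f => N 0 (L f)) (N 1).
Proof.
move=> e0 h; have [C C0 hC] := osc_norm0_le.
exists (Num.sqrt (C / e)) => // f; rewrite /osc_norm/=.
rewrite -ler_sqr ?nnegrE ?mulr_ge0 ?l2norm_ge0 ?sqrtr_ge0// exprMn (@sqr_sqrtr _ (C / e)); last first.
  by rewrite divr_ge0 ?(ltW e0)//.
rewrite l2norm_sqr mulrAC ler_pdivlMr// mulrC (le_trans (h f))//.
apply: (le_trans (le_trans (ler_norm _) (CauchySchwarz f (osc a b c f)))).
by rewrite expr2 mulrA ler_wpM2r ?l2norm_ge0//; exact: hC.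
Qed.

Lemma osc_normS_le m : dominated (N m) (N m.+1).
Proof.
have [C C0 h] := osc_norm0_le; exists C => // f.
by have := h (iter m (osc a b c) f).
Qed.

Lemma osc_norm_le m k : (m <= k)%N -> dominated (N m) (N k).
Proof.
move=> /subnK <-; elim: (k - m)%N => [|l IH]; first exact: dominated_le.
exact: dominated_trans IH (osc_normS_le _).
Qed.

(** Coercivity gives the case [m = 0]. For the step, commuting the oscillator
    with [X] produces a multiple of [D], and conversely, so that the two
    estimates are proved together. *)
Lemma osc_norm_XD m :
  dominated (fun f => N m (X f)) (N m.+1) /\ dominated (fun f => N m (D f)) (N m.+1).
Proof.
elim: m => [|m [IHX IHD]].
  split; [apply: (sqr_dominated0 b0)|apply: (sqr_dominated0 a0)] => f; rewrite ip_osc.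
    have := mulr_ge0 (ltW a0) (ip_ge0 (D f)); have := mulr_ge0 (ltW c0) (ip_ge0 f).
    by lra.
  have := mulr_ge0 (ltW b0) (ip_ge0 (X f)); have := mulr_ge0 (ltW c0) (ip_ge0 f).
  by lra.
have NS f : N m.+1 f = N m (osc a b c f) by rewrite /osc_norm iterSr.
have step (L L' : schwartz R -> schwartz R) k :
    (forall f, osc a b c (L f) = L (osc a b c f) + k *: L' f) ->
    dominated (fun f => N m (L f)) (N m.+1) -> dominated (fun f => N m (L' f)) (N m.+1) ->
    dominated (fun f => N m.+1 (L f)) (N m.+2).
  move=> hL [C C0 IHL] IHL'.
  apply: (dominated_trans (q := fun f => N m (L (osc a b c f)) + `|k| * N m (L' f))).
    apply: dominated_le => f; rewrite NS hL (le_trans (osc_normD _ _ _ _ _ _))//.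
    by rewrite lerD2l osc_normZ.
  apply: dominatedD.
    by exists C => // f; rewrite (le_trans (IHL _))// /osc_norm !iterSr.
  apply: dominatedZ => //; exact: dominated_trans IHL' (osc_normS_le _).
split.
- by apply: (step _ D (-2 * a)) => // f; exact: oscX.
- by apply: (step _ X (-2 * b)) => // f; exact: oscD.
Qed.

Lemma osc_norm_X2 m : dominated (fun f => N m (X (X f))) (N m.+2).
Proof.
have [[C C0 h] _] := osc_norm_XD m; have [h1 _] := osc_norm_XD m.+1.
by apply: dominated_trans h1; exists C.
Qed.

Lemma osc_norm_D2 m : dominated (fun f => N m (D (D f))) (N m.+2).
Proof.
have [_ [C C0 h]] := osc_norm_XD m; have [_ h1] := osc_norm_XD m.+1.
by apply: dominated_trans h1; exists C.
Qed.

Lemma osc_norm_osc a' b' c' m : dominated (fun f => N m (osc a' b' c' f)) (N m.+2).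
Proof.
apply: (dominated_trans (q := fun f =>
    `|a'| * N m (D (D f)) + `|b'| * N m (X (X f)) + `|c'| * N m f)).
  apply: dominated_le => f; rewrite (le_trans (osc_normD _ _ _ _ _ _))// lerD ?osc_normZ//.
  by rewrite (le_trans (osc_normD _ _ _ _ _ _))// !osc_normZ normrN.
by do 2?[apply: dominatedD]; apply: dominatedZ => //;
  [exact: osc_norm_D2|exact: osc_norm_X2|apply: osc_norm_le; rewrite -addn2 leq_addr].
Qed.

(** All oscillators with positive coefficients define the same topology. The
    loss from [m] to [2 m] comes from bounding [D^2] and [X^2] by one power each
    for [D] and for [X]. *)
Lemma osc_norm_compare a' b' c' m : dominated (osc_norm a' b' c' m) (N (2 * m)).
Proof.
elim: m => [|m [C C0 IH]]; first exact: dominated_le.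
have [E E0 h] := osc_norm_osc a' b' c' (2 * m).
exists (C * E) => [|f]; first exact: mulr_ge0.
rewrite mulnS -mulrA (le_trans _ (ler_wpM2l C0 (h f)))//.
by rewrite {1}/osc_norm iterSr; exact: IH.
Qed.

End positive.

End oscillator.

(** * Estimates in the Schwartz norms *)

Section schwartz_norms.
Variable R : realType.
Implicit Types (f g w : schwartz R) (c x : R).
Local Notation D := (@schwartz_deriv R).
Local Notation X := (@schwartz_mulX R).
Local Notation sn := (@schwartz_norm R).

Lemma schwartz_norm_osc m f : sn m f = osc_norm 2^-1 2^-1 2^-1 m f.
Proof.
rewrite schwartz_normE /osc_norm; congr l2norm.
by elim: m => //= m ->; rewrite numberop1E.
Qed.

Lemma schwartz_norm_funE m : sn m = osc_norm 2^-1 2^-1 2^-1 m.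
Proof. by apply/funext => f; exact: schwartz_norm_osc. Qed.

Let half_gt0 : 0 < 2^-1 :> R. Proof. by rewrite invr_gt0. Qed.

Lemma schwartz_norm0E f : sn 0 f = l2norm f.
Proof. by rewrite schwartz_norm_osc. Qed.

Lemma schwartz_norm_triangle m f g : sn m (f + g) <= sn m f + sn m g.
Proof. by rewrite !schwartz_norm_osc; exact: osc_normD. Qed.

Lemma schwartz_normZ m c f : sn m (c *: f) = `|c| * sn m f.
Proof. by rewrite !schwartz_norm_osc; exact: osc_normZ. Qed.

Lemma schwartz_norm_sum m n (F : nat -> schwartz R) :
  sn m (\sum_(i < n) F i) <= \sum_(i < n) sn m (F i).
Proof.
elim: n => [|n IH]; first by rewrite !big_ord0 schwartz_norm0.
rewrite !big_ord_recr/= (le_trans (schwartz_norm_triangle _ _ _))//.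
by rewrite lerD2r.
Qed.

Lemma schwartz_norm_le m k : (m <= k)%N -> dominated (sn m) (sn k).
Proof. by move=> mk; rewrite !schwartz_norm_funE; exact: osc_norm_le. Qed.

Lemma schwartz_norm_deriv m : dominated (fun f => sn m (D f)) (sn m.+1).
Proof. by rewrite !schwartz_norm_funE; have [] := osc_norm_XD half_gt0 half_gt0 half_gt0 m. Qed.

Lemma schwartz_norm_mulX2 m : dominated (fun f => sn m (X (X f))) (sn m.+2).
Proof. by rewrite !schwartz_norm_funE; exact: osc_norm_X2. Qed.

Lemma schwartz_norm_deriv2 m : dominated (fun f => sn m (D (D f))) (sn m.+2).
Proof. by rewrite !schwartz_norm_funE; exact: osc_norm_D2. Qed.

Lemma schwartz_normS m f : sn m.+1 f = sn m (numberop1 f).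
Proof. by rewrite !schwartz_normE iterSr. Qed.

(** [f(x)^2] is the integral of [2 f f'] up to [x], and [2 f f'] is at most
    [f^2 + f'^2] in absolute value. *)
Lemma schwartz_sobolev f x : `|f x| <= l2norm f + l2norm (D f).
Proof.
rewrite -ler_sqr ?nnegrE ?addr_ge0 ?l2norm_ge0// sqrrD real_normK ?num_real//.
have -> : f x ^+ 2 = schwartz_prim (D (schwartzM f f)) x.
  by rewrite schwartz_prim_deriv schwartzE expr2.
apply: (@le_trans _ _ (l2norm f ^+ 2 + l2norm (D f) ^+ 2)); last first.
  by rewrite lerD2r lerDl mulrn_wge0// mulr_ge0 ?l2norm_ge0.
set w := schwartzM f f + schwartzM (D f) (D f).
have w0 t : 0 <= w t by rewrite !schwartzE -!expr2 addr_ge0 ?sqr_ge0.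
have -> : l2norm f ^+ 2 + l2norm (D f) ^+ 2 =
    \int[lebesgue_measure]_(t in setT) `|w t|.
  rewrite !l2norm_sqr /ip -linearD/=; apply: eq_Rintegral => t _.
  by rewrite [RHS]ger0_norm//; exact: w0.
rewrite (le_trans (ler_norm _))// -[leLHS]mul1r -normr1 -normrM.
apply: schwartz_prim_left => t _; rewrite mul1r derivM [leRHS]ger0_norm//.
rewrite !schwartzE; move: (f t) (D f t) => p q.
rewrite ler_norml; apply/andP; split.
  by have := sqr_ge0 (p + q); rewrite sqrrD; lra.
by have := sqr_ge0 (p - q); rewrite sqrrB; lra.
Qed.

Lemma schwartz_sup_dominated :
  exists2 C : R, 0 <= C & forall f x, `|f x| <= C * sn 1 f.
Proof.
have h : dominated (fun f => l2norm f + l2norm (D f)) (sn 1).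
  apply: dominatedD.
    have [C C0 hC] := schwartz_norm_le (leq0n 1); exists C => // f.
    by rewrite -schwartz_norm0E.
  have [C C0 hC] := schwartz_norm_deriv 0; exists C => // f.
  by rewrite -schwartz_norm0E.
have [C C0 hC] := h; exists C => // f x; exact: le_trans (schwartz_sobolev f x) _.
Qed.

(** The supremum of [(1 + x^2) f] is controlled by a Schwartz norm, and
    [1 / (1 + x^2)] is integrable. *)
Lemma lebesgue_int_dominated : exists2 C : R, 0 <= C &
  forall (A : set R) f, lebesgue_measurable A -> `|lebesgue_int A f| <= C * sn 3 f.
Proof.
have [C C0 hC] := schwartz_sup_dominated.
have h : dominated (fun f => sn 1 (f + X (X f))) (sn 3).
  apply: (dominated_trans (q := fun f => sn 1 f + sn 1 (X (X f)))).
    by apply: dominated_le => f; exact: schwartz_norm_triangle.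
  by apply: dominatedD; [exact: schwartz_norm_le|exact: schwartz_norm_mulX2].
have [E E0 hE] := h; set P := \int[lebesgue_measure]_(x in setT) (@oneDsqr R x)^-1.
have P0 : 0 <= P by apply: Rintegral_ge0 => x _; rewrite invr_ge0 (le_trans ler01 (oneDsqr_ge1 x)).
exists (C * E * P) => [|A f mA]; first by rewrite !mulr_ge0.
rewrite (_ : _ * _ * _ = C * (E * sn 3 f) * P); last by ring.
apply: le_lebesgue_int => // x.
have d0 : 0 < oneDsqr x :> R by rewrite (lt_le_trans ltr01 (oneDsqr_ge1 x)).
rewrite ler_pdivlMr// -{1}(ger0_norm (ltW d0)) -normrM.
rewrite (_ : f x * _ = (f + X (X f)) x); last by rewrite !schwartzE /oneDsqr; ring.
by rewrite (le_trans (hC _ _))// ler_wpM2l.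
Qed.

Lemma dominatedM (p p' q q' : schwartz R -> R) :
  (forall f, 0 <= p f) -> (forall f, 0 <= p' f) -> dominated p q -> dominated p' q' ->
  dominated (fun t : schwartz R * schwartz R => p t.1 * p' t.2)
            (fun t => q t.1 * q' t.2).
Proof.
move=> p0 p'0 [C C0 pq] [E E0 pq']; exists (C * E) => [|t]; first exact: mulr_ge0.
by rewrite mulrACA ler_pM.
Qed.

(** The Leibniz rule for [N + 1], which drives the induction of
    [schwartz_normM]. *)
Lemma numberop1M f g : numberop1 (schwartzM f g) =
  schwartzM (numberop1 f) g + (- (schwartzM (D f) (D g)) + (- 2^-1) *: schwartzM f (D (D g))).
Proof.
rewrite /numberop1 derivM (linearD (@schwartz_deriv R))/= !derivM; apply: schwartz_ext => x; rewrite !schwartzE.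
by move: (D (D f) x) (D (D g) x) (D f x) (D g x) (f x) (g x) => p q r s u v; field.
Qed.

(** By induction on [m]: the case [m = 0] bounds one factor by its supremum, and
    [numberop1M] reduces the norm of index [m + 1] of a product to norms of
    index [m] of three products. *)
Lemma schwartz_normM m : exists k, dominated
  (fun t : schwartz R * schwartz R => sn m (schwartzM t.1 t.2))
  (fun t => sn k t.1 * sn k t.2).
Proof.
elim: m => [|m [k [C C0 IH]]].
  exists 1%N; have [C C0 hC] := schwartz_sup_dominated.
  apply: (dominated_trans (q := fun t => (C * sn 1 t.1) * sn 0 t.2)); last first.
    apply: (@dominatedM (fun f => C * sn 1 f) (sn 0) (sn 1) (sn 1)) => [f|f||];
      rewrite ?mulr_ge0 ?schwartz_norm_ge0//.
      by apply: dominatedZ => //; exact: dominated_le.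
    exact: schwartz_norm_le.
  apply: dominated_le => -[f g] /=; rewrite !schwartz_norm0E.
  have a0 : 0 <= C * sn 1 f by rewrite mulr_ge0 ?schwartz_norm_ge0.
  have b0 : 0 <= C * sn 1 f * l2norm g by rewrite mulr_ge0 ?l2norm_ge0.
  have := ler_sqr (l2norm_ge0 (schwartzM f g) : _ \in Num.nneg) (b0 : _ \in Num.nneg).
  move=> <-; rewrite exprMn !l2norm_sqr /ip -linearZ/= -subr_ge0 -linearB/=.
  apply: schwartz_int_ge0 => x; rewrite !schwartzE subr_ge0 mulrACA -!expr2.
  by rewrite ler_wpM2r ?sqr_ge0// -real_normK ?num_real// lerXn2r.
exists k.+2.
have s0 n f : 0 <= sn n f by exact: schwartz_norm_ge0.
apply: (dominated_trans (q := fun t => C * (sn k (numberop1 t.1) * sn k t.2) +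
   (C * (sn k (D t.1) * sn k (D t.2)) + 2^-1 * (C * (sn k t.1 * sn k (D (D t.2))))))).
  apply: dominated_le => -[f g]/=; rewrite schwartz_normS numberop1M.
  apply: le_trans (schwartz_norm_triangle _ _ _) _.
  apply: lerD; first exact: (IH (numberop1 f, g)).
  apply: le_trans (schwartz_norm_triangle _ _ _) _.
  apply: lerD; first by rewrite schwartz_normN; exact: (IH (D f, D g)).
  rewrite schwartz_normZ normrN ger0_norm; last exact: (ltW half_gt0).
  by apply: ler_wpM2l; [exact: (ltW half_gt0)|exact: (IH (f, D (D g)))].
apply: dominatedD; [|apply: dominatedD]; do ?[apply: dominatedZ; first by rewrite ?invr_ge0].
- apply: (@dominatedM (fun f => sn k (numberop1 f)) (sn k) (sn k.+2) (sn k.+2)) => //.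
    apply: (dominated_trans (q := sn k.+1)); last exact: schwartz_norm_le.
    by apply: dominated_le => f; rewrite schwartz_normS.
  by apply: schwartz_norm_le; rewrite -addn2 leq_addr.
- apply: (@dominatedM (fun f => sn k (D f)) (fun f => sn k (D f)) (sn k.+2) (sn k.+2)) => //;
  exact: dominated_trans (schwartz_norm_deriv k) (schwartz_norm_le (leqnSn _)).
- apply: (@dominatedM (sn k) (fun f => sn k (D (D f))) (sn k.+2) (sn k.+2)) => //.
    by apply: schwartz_norm_le; rewrite -addn2 leq_addr.
  exact: schwartz_norm_deriv2.
Qed.

End schwartz_norms.

(** * Ladder operators and Hermite functions *)

Section ladder.
Variable R : realType.
Implicit Types (f g w psi chi : schwartz R) (c x : R).
Local Notation D := (@schwartz_deriv R).
Local Notation X := (@schwartz_mulX R).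
Local Notation h := (hermite R).

(** The annihilation and creation operators of the oscillator
    [osc 1 4^-1 2^-1]; the coefficient [2^-1] matches the weight
    [expR (- x^2 / 4)] of the Hermite functions. *)
Definition lower f : schwartz R := D f + 2^-1 *: X f.
Definition raise f : schwartz R := - D f + 2^-1 *: X f.

Lemma raise_is_linear : linear raise.
Proof.
move=> k f g; rewrite /raise !linearP; apply: schwartz_ext => x; rewrite !schwartzE.
by move: (D f x) (D g x) (f x) (g x) => p q r s; ring.
Qed.
HB.instance Definition _ := GRing.isLinear.Build R (schwartz R) (schwartz R) _ raise
  raise_is_linear.

Lemma lower_is_linear : linear lower.
Proof.
move=> k f g; rewrite /lower !linearP; apply: schwartz_ext => x; rewrite !schwartzE.
by move: (D f x) (D g x) (f x) (g x) => p q r s; ring.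
Qed.
HB.instance Definition _ := GRing.isLinear.Build R (schwartz R) (schwartz R) _ lower
  lower_is_linear.

Lemma ip_raise f g : ip (raise f) g = ip f (lower g).
Proof. by rewrite /raise /lower !ipE ip_deriv ip_mulX opprK. Qed.

Lemma ip_lower f g : ip (lower f) g = ip f (raise g).
Proof. by rewrite ipC -ip_raise ipC. Qed.

(** The canonical commutation relation. *)
Lemma lower_raise f : lower (raise f) = raise (lower f) + f.
Proof.
rewrite /lower /raise !(linearD D)/= !(linearD X)/= !linearN/= !linearZ/= derivX.
apply: schwartz_ext => x; rewrite !schwartzE.
by move: (D (D f) x) (D f x) (f x) => p q r; field.
Qed.

Lemma osc_ladder f : osc 1 4^-1 2^-1 f = raise (lower f) + f.
Proof.
rewrite /osc /lower /raise !(linearD D)/= !linearZ/= derivX.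
apply: schwartz_ext => x; rewrite !schwartzE.
by move: (D (D f) x) (D f x) (f x) => p q r; field.
Qed.

Definition hermite_const n : R := (Num.sqrt (Num.sqrt (2 * pi) * n`!%:R))^-1.

Lemma hermite_const_gt0 n : 0 < hermite_const n.
Proof.
rewrite invr_gt0 sqrtr_gt0 mulr_gt0 ?ltr0n ?fact_gt0//.
by rewrite sqrtr_gt0 mulr_gt0// pi_gt0.
Qed.

Lemma hermite_constS n : hermite_const n = Num.sqrt n.+1%:R * hermite_const n.+1.
Proof.
have p0 : 0 <= Num.sqrt (2 * pi) :> R by exact: sqrtr_ge0.
rewrite /hermite_const factS natrM mulrCA [in RHS]sqrtrM ?ler0n//.
rewrite invfM mulrA divff ?mul1r// gt_eqF// sqrtr_gt0 ltr0n//.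
Qed.

Lemma is_derive_gauss4 x : is_derive x 1 (fun y : R => expR (- (y ^+ 2 / 4)))
  (- (x / 2) * expR (- (x ^+ 2 / 4))).
Proof.
have d1 : is_derive x 1 (fun y : R => - (y ^+ 2 / 4)) (- (x / 2)).
  by apply: is_derive_eq; rewrite /GRing.scale/=; field.
have := @is_derive1_comp _ expR (fun y : R => - (y ^+ 2 / 4)) x _ _ (is_derive_expR _) d1.
by rewrite mulrC.
Qed.

Lemma hermiteE n x : h n x = hermite_const n * (-1) ^+ n * expR (x ^+ 2 / 4) *
  derive1n n (fun y => expR (- (y ^+ 2 / 2))) x.
Proof.
rewrite /= /hermite_fun /hermite_poly -/(hermite_const n).
have -> : x ^+ 2 / 2 = x ^+ 2 / 4 + x ^+ 2 / 4 by field.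
rewrite [expR (_ + _)]expRD expRN; have := expR_gt0 (x ^+ 2 / 4) => /lt0r_neq0.
by move: (expR _) (hermite_const n) ((-1) ^+ n) (derive1n _ _ _) => e k s d e0; field.
Qed.

(** Rodrigues' formula, solved for the derivatives of the Gaussian; one more
    derivation yields the recurrence [raise_hermite]. *)
Lemma gauss_derive1n n x : derive1n n (fun y : R => expR (- (y ^+ 2 / 2))) x =
  (-1) ^+ n / hermite_const n * (h n x * expR (- (x ^+ 2 / 4))).
Proof.
rewrite hermiteE expRN; have := expR_gt0 (x ^+ 2 / 4) => /lt0r_neq0.
have := lt0r_neq0 (hermite_const_gt0 n).
rewrite (_ : (-1) ^+ n / _ * _ = ((-1) ^+ n * (-1) ^+ n) * (hermite_const n / hermite_const n) *
  (expR (x ^+ 2 / 4) / expR (x ^+ 2 / 4)) * 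
  derive1n n (fun y : R => expR (- (y ^+ 2 / 2))) x); last by ring.
by move=> k0 e0; rewrite !divff// -expr2 sqrr_sign !mul1r.
Qed.

Lemma raise_hermite n : raise (h n) = Num.sqrt n.+1%:R *: h n.+1.
Proof.
apply: schwartz_ext => x.
have := gauss_derive1n n.+1 x; rewrite derive1nS derive1E.
have -> : derive1n n (fun y : R => expR (- (y ^+ 2 / 2))) =
  ((-1) ^+ n / hermite_const n) \*: ((h n : R -> R) * (fun y => expR (- (y ^+ 2 / 4)))).
  by apply/funext => y; rewrite gauss_derive1n.
have := is_deriveZ ((-1) ^+ n / hermite_const n)
  (is_deriveM (schwartz_is_derive (h n) x) (is_derive_gauss4 x)).
case=> _ ->.
rewrite hermite_constS !schwartzE /GRing.scale/= [(-1) ^+ n.+1]exprS.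
have := lt0r_neq0 (hermite_const_gt0 n.+1); have := lt0r_neq0 (expR_gt0 (- (x ^+ 2 / 4))).
have : Num.sqrt n.+1%:R != 0 :> R by rewrite gt_eqF// sqrtr_gt0 ltr0n.
have : (-1) ^+ n != 0 :> R by rewrite signr_eq0.
move: (hermite_fun n.+1 x) (hermite_fun n x) (derive1 _ x) (expR _) (hermite_const _) (Num.sqrt _) ((-1) ^+ n).
move=> u v v' e k s m m0 s0 e0 k0 E.
(* Multiplying by these nonzero factors turns the goal into a multiple of [E]. *)
apply: (mulIf e0); apply: (mulfI m0); apply: (mulIf (invr_neq0 k0)).
apply: (mulIf (invr_neq0 s0)).
transitivity (- (m / (s * k) * (v * (- (x / 2) * e) + e * v'))); first by field; rewrite k0.
transitivity (- (-1 * m / k * (u * e))); first by congr (- _); exact: E.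
by field; rewrite s0.
Qed.

Lemma hermite0E x : h 0 x = hermite_const 0 * expR (- (x ^+ 2 / 4)).
Proof.
rewrite hermiteE expr0 mulr1 derive1n0.
have -> : - (x ^+ 2 / 2) = - (x ^+ 2 / 4) + - (x ^+ 2 / 4) by field.
by rewrite expRD mulrA -[_ * expR (x ^+ 2 / 4) * _]mulrA -expRD subrr expR0 mulr1.
Qed.

Lemma lower_hermite0 : lower (h 0) = 0.
Proof.
apply: schwartz_ext => x; rewrite !schwartzE /lower.
have E : (h 0 : R -> R) = hermite_const 0 \*: (fun y => expR (- (y ^+ 2 / 4))).
  by apply/funext => y; rewrite hermite0E.
have := is_deriveZ (hermite_const 0) (is_derive_gauss4 x); rewrite -E.
case: (schwartz_is_derive (h 0) x) => _ e1 [_ e2].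
rewrite -e1 e2 hermite0E /GRing.scale/=.
by move: (expR _) => e; field.
Qed.

Lemma raise_lower_hermite n : raise (lower (h n)) = n%:R *: h n.
Proof.
elim: n => [|n IH]; first by rewrite lower_hermite0 linear0 scale0r.
have s0 : Num.sqrt n.+1%:R != 0 :> R by rewrite gt_eqF// sqrtr_gt0 ltr0n.
apply: (scalerI s0); rewrite -!linearZ/= -raise_hermite lower_raise IH.
rewrite -[X in _ + X]scale1r -scalerDl -natr1 linearZ/= raise_hermite.
by rewrite scalerA mulrC -scalerA.
Qed.

Lemma lower_hermite n : lower (h n.+1) = Num.sqrt n.+1%:R *: h n.
Proof.
have s0 : Num.sqrt n.+1%:R != 0 :> R by rewrite gt_eqF// sqrtr_gt0 ltr0n.
apply: (scalerI s0); rewrite -linearZ/= -raise_hermite lower_raise raise_lower_hermite.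
rewrite scalerA -expr2 sqr_sqrtr ?ler0n//.
by rewrite -[X in _ + X]scale1r -scalerDl natr1.
Qed.

(** The Hermite functions of weight [expR (- x^2 / 4)] diagonalise this
    oscillator, and not [N + 1]; hence the need for [osc_norm_compare]. *)
Lemma osc_hermite n : osc 1 4^-1 2^-1 (h n) = n.+1%:R *: h n.
Proof.
by rewrite osc_ladder raise_lower_hermite -[X in _ + X]scale1r -scalerDl natr1.
Qed.

(** The square of [h 0] is the density of the standard normal law. *)
Lemma ip_hermite0 : ip (h 0) (h 0) = 1.
Proof.
have /(congr1 fine)/= <- := @integral_normal_pdf R 0 1.
congr fine; apply: eq_integral => x _; congr (_%:E).
rewrite normal_pdfE ?oner_eq0// schwartzME !hermite0E /normal_peak /normal_fun.
rewrite /hermite_const fact0 mulr1 mulrACA -expr2 exprVn sqr_sqrtr ?sqrtr_ge0//.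
rewrite expr1n mul1r -[pi *+ 2]mulr_natl -expRD; congr (_ * expR _).
by rewrite subr0; field.
Qed.

Lemma ip_hermite i j : ip (h i) (h j) = (i == j)%:R.
Proof.
have s0 n : Num.sqrt n.+1%:R != 0 :> R by rewrite gt_eqF// sqrtr_gt0 ltr0n.
elim: i j => [|i IH] [|j].
- exact: ip_hermite0.
- apply: (mulfI (s0 j)); rewrite -ipZr -raise_hermite -ip_lower lower_hermite0 mulr0.
  by rewrite ipC linear0.
- apply: (mulfI (s0 i)); rewrite -ipZl -raise_hermite ip_raise lower_hermite0 mulr0.
  by rewrite linear0.
- apply: (mulfI (s0 i)); rewrite -ipZl -raise_hermite ip_raise lower_hermite ipZr IH eqSS.
  by have [->|_] := eqVneq i j; rewrite ?mulr0.
Qed.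

End ladder.

(** * The spectral gap and the decay of Hermite remainders *)

Section raise_surjective.
Variable R : realType.
Implicit Types (f g w psi chi : schwartz R) (c x : R).
Local Notation D := (@schwartz_deriv R).
Local Notation X := (@schwartz_mulX R).
Local Notation h := (hermite R).

Lemma iter_mulXE a f x : iter a X f x = x ^+ a * f x.
Proof. by elim: a => [|a IH]; rewrite ?expr0 ?mul1r//= exprS -mulrA -IH. Qed.

Lemma is_schwartz_poly (p : {poly R}) f : is_schwartz (fun x => p.[x] * f x).
Proof.
elim/poly_ind: p => [|p k IH].
  rewrite (_ : (fun _ => _) = 0); first exact: is_schwartz0.
  by apply/funext => x; rewrite horner0 mul0r.
rewrite (_ : (fun _ => _) = (id * (fun x => p.[x] * f x)) + (k *: (f : R -> R))).
  apply: is_schwartzD; first exact: is_schwartz_mulX.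
  exact/is_schwartzZ/schwartz_is_schwartz.
apply/funext => x; rewrite hornerD hornerM hornerX hornerC.
transitivity (x * (p.[x] * f x) + k * f x); last by [].
by move: (p.[x]) (f x) => q r; ring.
Qed.

Lemma rapidly_decreasing_poly (p : {poly R}) (u : R -> R) : rapidly_decreasing u ->
  rapidly_decreasing (fun x => p.[x] * u x).
Proof.
move=> ru; elim/poly_ind: p => [a|p k IH a].
  by exists 0 => x; rewrite horner0 mul0r mulr0 normr0.
have [C hC] := IH a.+1; have [E hE] := ru a; exists (C + `|k| * E) => x.
have -> : x ^+ a * ((p * 'X + k%:P).[x] * u x) =
    x ^+ a.+1 * (p.[x] * u x) + k * (x ^+ a * u x).
  by rewrite hornerD hornerM hornerX hornerC exprS; ring.
by rewrite (le_trans (ler_normD _ _))// lerD// normrM ler_wpM2l.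
Qed.

Variable psi : schwartz R.
Hypothesis psi0 : ip psi (h 0) = 0.

Let g := schwartzM psi (h 0).
(** The equation [raise chi = psi] says that the derivative of
    [expR (- x^2 / 4) chi] is [- expR (- x^2 / 4) psi], and [h 0] is a
    multiple of that exponential. *)
Let chi0 x : R := - (h 0 x)^-1 * schwartz_prim g x.

Let h0_gt0 x : 0 < h 0 x.
Proof. by rewrite hermite0E mulr_gt0 ?hermite_const_gt0 ?expR_gt0. Qed.

Let h0_le x y : x ^+ 2 <= y ^+ 2 -> h 0 y <= h 0 x.
Proof.
move=> xy; rewrite !hermite0E ler_pM2l ?hermite_const_gt0// ler_expR lerN2.
by rewrite ler_pM2r// invr_gt0.
Qed.

(** For [x <= 0] the factor [h 0 t / h 0 x] is at most 1 on the domain of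
    integration [t <= x], and [|x|^a <= |t|^a] there, so that the decay of [psi]
    passes to [chi0]. For [x > 0] the orthogonality to [h 0] lets one integrate
    over [t >= x] instead. *)
Let chi0_rapid : rapidly_decreasing chi0.
Proof.
move=> a; exists (\int[@lebesgue_measure R]_(t in setT) `|iter a X psi t|) => x.
have key t : `|x| <= `|t| -> `|x ^+ a * - (h 0 x)^-1 * g t| <= `|iter a X psi t|.
  move=> xt; rewrite iter_mulXE /g schwartzME.
  have hxt : h 0 t <= h 0 x.
    by apply: h0_le; rewrite -(real_normK (num_real x)) -(real_normK (num_real t)) lerXn2r.
  have := h0_gt0 t; have := h0_gt0 x.
  move: hxt; move: (h 0 t) (h 0 x) (psi t) => q r s qr r0 q0.
  rewrite [s * _]mulrC mulrA !normrM ler_wpM2r// -[leRHS]mulr1 -mulrA ler_pM ?mulr_ge0//.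
    by rewrite !normrX lerXn2r.
  by rewrite normrN normfV !gtr0_norm// mulrC ler_pdivrMr// mul1r.
rewrite /chi0 mulrA; have [x0|x0] := leP x 0.
  apply: schwartz_prim_left => t tx; apply: key.
  by rewrite !ler0_norm//; lra.
have -> : schwartz_prim g x = - (schwartz_int g - schwartz_prim g x).
  by rewrite -[schwartz_int g]/(ip psi (h 0)) psi0 sub0r opprK.
rewrite mulrN normrN.
apply: schwartz_prim_right => t tx; apply: key.
by rewrite !gtr0_norm//; lra.
Qed.

Let h0_deriv x : D (h 0) x = - (x / 2) * h 0 x.
Proof.
have := congr1 (fun f : schwartz R => f x) (lower_hermite0 R).
rewrite /lower schwartzDE schwartzZE schwartz_mulXE schwartz0E.
move: (D (h 0) x) (h 0 x) => p q.
by move/eqP; rewrite addr_eq0 => /eqP ->; field.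
Qed.

Let chi0_is_derive x : is_derive x 1 chi0 (x / 2 * chi0 x - psi x).
Proof.
have n0 : h 0 x != 0 by rewrite gt_eqF.
have d1 := is_deriveV n0 (schwartz_is_derive (h 0) x).
have hd : is_derive x 1 chi0 _ :=
  is_deriveM (is_deriveN d1) (schwartz_prim_is_derive g x).
apply: (is_derive_eq hd).
transitivity (- (h 0 x)^-1 * (psi x * h 0 x) +
  schwartz_prim g x * - (- (h 0 x) ^- 2 * D (h 0) x)); first by [].
rewrite h0_deriv /chi0; move: n0; move: (schwartz_prim _ _) (psi x) (h 0 x) => P s e e0.
by field.
Qed.

Let chi0_schwartz : is_schwartz chi0.
Proof.
(* Derivation leaves this set stable because [chi0' = x / 2 * chi0 - psi]. *)
apply: (@is_schwartz_coind _ [set u | exists (p : {poly R}) s,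
   is_schwartz s /\ u = (fun x => p.[x] * chi0 x) + s]); last first.
  exists 1, 0; split; first exact: is_schwartz0.
  by apply/funext => x; rewrite addr0 hornerC mul1r.
move=> _ [p [s [ss ->]]].
have d (y : R) : is_derive y 1 ((fun x => p.[x] * chi0 x) + s)
    ((p^`() + 2^-1 *: ('X * p)).[y] * chi0 y + (derive1 s y - p.[y] * psi y)).
  have ds : is_derive y 1 s (derive1 s y).
    by apply: DeriveDef; [exact: is_schwartz_derivable|rewrite derive1E].
  apply: (is_derive_eq (is_deriveD (is_deriveM (is_derive_poly p y) (chi0_is_derive y)) ds)).
  transitivity (p.[y] * (y / 2 * chi0 y - psi y) + chi0 y * p^`().[y] + derive1 s y).
    by [].
  rewrite hornerD hornerZ hornerM hornerX; move: (chi0 y) (psi y) (derive1 s y) (p.[y]) (p^`().[y]) => q r t u v; by field.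
split=> [x||].
- by case: (d x).
- exists (p^`() + 2^-1 *: ('X * p)), (derive1 s - (fun y => p.[y] * psi y)); split.
    apply: is_schwartzD; first exact: is_schwartz_derive1.
    rewrite -scaleN1r; apply: is_schwartzZ; exact: is_schwartz_poly.
  by apply/funext => y; rewrite derive1E; case: (d y).
- apply: rapidly_decreasingD; last exact: is_schwartz_rapid.
  exact: (rapidly_decreasing_poly p chi0_rapid).
Qed.

(** The function [h 0] spans the kernel of [lower], the adjoint of [raise]; so
    orthogonality to [h 0] is the natural solvability condition, and it suffices
    among Schwartz functions. *)
Lemma raise_surjective : exists chi, psi = raise chi.
Proof.
exists (to_schwartz chi0_schwartz); apply: schwartz_ext => x.
rewrite /raise schwartzDE schwartzNE schwartzZE schwartz_mulXE.
have -> : D (to_schwartz chi0_schwartz) x = x / 2 * chi0 x - psi x.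
  by case: (schwartz_is_derive (to_schwartz chi0_schwartz) x) => _ <-; case: (chi0_is_derive x).
by rewrite -[to_schwartz _ x]/(chi0 x); move: (chi0 x) (psi x) => p q; field.
Qed.

End raise_surjective.

Section spectral_gap.
Variable R : realType.
Implicit Types (f g w psi chi phi : schwartz R) (c x : R).
Local Notation h := (hermite R).
Local Notation M := (osc 1 4^-1 2^-1).
Local Notation N := (osc_norm (1 : R) 4^-1 2^-1).

Definition hermite_orth n psi := forall j, (j < n)%N -> ip psi (h j) = 0.

(** Induction on [n]. Write [psi = raise chi]; then [chi] is orthogonal to one
    Hermite function less, and the commutation relation gives
    [|psi|^2 = |lower chi|^2 + |chi|^2 >= (n + 1) |chi|^2]. The conclusion
    follows from [|psi|^2 = ip chi (lower psi) <= |chi| |lower psi|]. *)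
Lemma lower_gap n psi : hermite_orth n psi ->
  n%:R * ip psi psi <= ip (lower psi) (lower psi).
Proof.
elim: n psi => [|n IH] psi ho; first by rewrite mul0r ip_ge0.
have [chi psiE] := raise_surjective (ho 0 isT).
have chi_orth : hermite_orth n chi.
  move=> j jn; have s0 : Num.sqrt j.+1%:R != 0 :> R by rewrite gt_eqF// sqrtr_gt0 ltr0n.
  by apply: (mulfI s0); rewrite -ipZr -lower_hermite -ip_raise -psiE ho// mulr0.
have e1 : ip psi psi = ip (lower chi) (lower chi) + ip chi chi.
  by rewrite {1}psiE ip_raise psiE lower_raise ipDr -ip_lower.
have e2 : n.+1%:R * ip chi chi <= ip psi psi.
  by rewrite e1 -natr1 mulrDl mul1r lerD2r; exact: IH.
have e3 : ip psi psi ^+ 2 <= ip chi chi * ip (lower psi) (lower psi).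
  have := CauchySchwarz chi (lower psi); rewrite -ip_raise -psiE.
  rewrite -!l2norm_sqr -exprMn => hle; rewrite lerXn2r ?nnegrE ?sqr_ge0 ?mulr_ge0 ?l2norm_ge0//.
  by rewrite (le_trans _ hle)// l2norm_sqr ler_norm.
have := ip_ge0 psi; rewrite le_eqVlt => /orP[/eqP <-|p0]; first by rewrite mulr0 ip_ge0.
rewrite -(ler_pM2l p0) mulrCA -expr2.
apply: (le_trans (ler_wpM2l (ler0n _ n.+1) e3)).
by rewrite mulrA ler_wpM2r ?ip_ge0.
Qed.

(** The spectral gap. It is the quantitative form of the completeness of the
    Hermite functions. *)
Lemma osc_gap n psi : hermite_orth n psi -> n.+1%:R * l2norm psi <= l2norm (M psi).
Proof.
move=> ho; have := l2norm_ge0 psi; rewrite le_eqVlt => /orP[/eqP <-|p0].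
  by rewrite mulr0 l2norm_ge0.
rewrite -(ler_pM2l p0) (le_trans _ (le_trans (ler_norm _) (CauchySchwarz _ _)))//.
rewrite mulrCA -expr2 l2norm_sqr osc_ladder ipDr -ip_lower -natr1 mulrDl mul1r lerD2r.
exact: lower_gap.
Qed.

Lemma ip_oscC f g : ip (M f) g = ip f (M g).
Proof. by rewrite !osc_ladder ipDl ipDr ip_raise ip_lower. Qed.

Lemma hermite_orth_osc n psi : hermite_orth n psi -> hermite_orth n (M psi).
Proof. by move=> ho j jn; rewrite ip_oscC osc_hermite ipZr ho// mulr0. Qed.

(** Applying the oscillator preserves orthogonality to Hermite functions, so the
    gap can be used once for each power. *)
Lemma osc_gap_iter k n m psi : hermite_orth n psi ->
  n.+1%:R ^+ k * N m psi <= N (k + m) psi.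
Proof.
move=> ho; have hoi i : hermite_orth n (iter i M psi).
  by elim: i => //= i; exact: hermite_orth_osc.
elim: k => [|k IH]; first by rewrite mul1r.
rewrite exprS -mulrA (le_trans (ler_wpM2l _ IH))//.
exact: osc_gap.
Qed.

Definition hermite_proj n phi : schwartz R := \sum_(j < n) ip phi (h j) *: h j.

Lemma hermite_proj_orth n phi : hermite_orth n (phi - hermite_proj n phi).
Proof.
move=> j jn; rewrite ipDl ipNl; apply/eqP; rewrite subr_eq0; apply/eqP.
rewrite [RHS]ipC /hermite_proj linear_sum/= (bigD1 (Ordinal jn))//= big1 => [|i ij].
  by rewrite ipZr ip_hermite eqxx mulr1 addr0.
rewrite ipZr ip_hermite; case: eqP => [ji|]; last by rewrite mulr0.
by move: ij; rewrite -val_eqE/= ji eqxx.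
Qed.

Lemma hermite_proj_osc n phi : M (hermite_proj n phi) = hermite_proj n (M phi).
Proof.
rewrite /hermite_proj linear_sum/=; apply: eq_bigr => i _.
by rewrite linearZ/= osc_hermite scalerA ip_oscC osc_hermite ipZr mulrC.
Qed.

Lemma l2norm_hermite_rem n phi : l2norm (phi - hermite_proj n phi) <= l2norm phi.
Proof.
set r := phi - _; have rp : ip r (hermite_proj n phi) = 0.
  rewrite /hermite_proj linear_sum/= big1// => i _.
  by rewrite ipZr hermite_proj_orth ?mulr0.
have := l2norm_ge0 r; rewrite le_eqVlt => /orP[/eqP <-|r0]; first exact: l2norm_ge0.
rewrite -(ler_pM2l r0) (le_trans _ (le_trans (ler_norm _) (CauchySchwarz _ _)))//.
by rewrite -expr2 l2norm_sqr {2}/r ipDr ipNr rp subr0.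
Qed.

Lemma osc_norm_hermite_rem n m phi : N m (phi - hermite_proj n phi) <= N m phi.
Proof.
rewrite /osc_norm (_ : iter m M _ = iter m M phi - hermite_proj n (iter m M phi)).
  exact: l2norm_hermite_rem.
by elim: m => //= m ->; rewrite linearB/= hermite_proj_osc.
Qed.

(** The remainder is orthogonal to the first [n] Hermite functions, so the gap
    applies; and since projections commute with the oscillator and contract the
    norm, the right-hand side does not depend on [n]. *)
Lemma hermite_rem_decay k m n phi :
  n.+1%:R ^+ k * N m (phi - hermite_proj n phi) <= N (k + m) phi.
Proof.
apply: (le_trans (osc_gap_iter k m (@hermite_proj_orth n phi))).
exact: osc_norm_hermite_rem.
Qed.

Lemma osc_norm_hermite m n : N m (h n) = n.+1%:R ^+ m.
Proof.
rewrite /osc_norm (_ : iter m M (h n) = n.+1%:R ^+ m *: h n).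
  by rewrite l2normZ /l2norm ip_hermite eqxx sqrtr1 mulr1 ger0_norm.
elim: m => [|m IH]; first by rewrite expr0 scale1r.
by rewrite iterS IH linearZ/= osc_hermite scalerA exprSr.
Qed.

End spectral_gap.

(** * Classes of sequences *)

Section sequences.
Variable R : realType.
Local Open Scope quotient_scope.
Implicit Types (u v w : nat -> R) (C E : R).

Lemma tempered_seq_dom u w C : u \in tempered_seq_pred R ->
  (forall n, `|w n| <= C * `|u n|) -> w \in tempered_seq_pred R.
Proof.
move=> hu hw; apply: (tempered_seq_le (C := `|C|) hu hu) => n.
rewrite (le_trans (hw n))// mulrDr -[leLHS]addr0 lerD ?mulr_ge0//.
by rewrite ler_wpM2r// ler_norm.
Qed.

Lemma tempered_seqM u v : u \in tempered_seq_pred R -> v \in tempered_seq_pred R ->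
  (fun n => u n * v n) \in tempered_seq_pred R.
Proof. by have [_ _ h] := tempered_seq_subring_closed R; exact: h. Qed.

Lemma tempered_seqD u v : u \in tempered_seq_pred R -> v \in tempered_seq_pred R ->
  (fun n => u n + v n) \in tempered_seq_pred R.
Proof.
move=> hu hv; apply: (tempered_seq_le (C := 1) hu hv) => n.
by rewrite mul1r ler_normD.
Qed.

Lemma tempered_seq_cst C : (fun=> C) \in tempered_seq_pred R.
Proof. by apply/asboolP; exists `|C|, 0%N => n; rewrite expr0 mulr1. Qed.

Lemma rapid_seq_dom u w C : u \in rapid_seq_pred R ->
  (forall n, `|w n| <= C * `|u n|) -> w \in rapid_seq_pred R.
Proof.
move=> hu hw; apply: (rapid_seq_le (C := C) (E := 0) (k := 0) hu hu) => n.
by rewrite mul0r addr0 expr0 mulr1.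
Qed.

Lemma rapid_seqM u v w C : u \in tempered_seq_pred R -> v \in rapid_seq_pred R ->
  0 <= C -> (forall n, `|w n| <= C * (`|u n| * `|v n|)) -> w \in rapid_seq_pred R.
Proof.
move=> /asboolP[A [k hA]] hv C0 hw.
apply: (rapid_seq_le (C := C * A) (E := 0) (k := k) hv hv) => n.
by rewrite mul0r addr0 (le_trans (hw n))// -!mulrA ler_wpM2l// mulrA ler_wpM2r.
Qed.

Lemma sum_inv_sqr n : \sum_(i < n) (i.+1%:R ^- 2 : R) <= 2.
Proof.
(* Comparison with a telescoping sum. *)
suff h : \sum_(i < n.+1) (i.+1%:R ^- 2 : R) <= 2 - n.+1%:R^-1.
  have n0 : 0 <= n.+1%:R^-1 :> R by [].
  have m0 : 0 <= n.+1%:R ^- 2 :> R by rewrite -exprVn exprn_ge0.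
  rewrite (le_trans _ (le_trans h _)) ?gerBl//.
  by rewrite big_ord_recr/= lerDl.
elim: n => [|n IH]; first by rewrite big_ord_recr big_ord0/= expr1n invr1; lra.
rewrite big_ord_recr/= (le_trans (lerD IH (lexx _)))//.
rewrite -[n.+2%:R]natr1; have : 1 <= n.+1%:R :> R by rewrite ler1n.
move: n.+1%:R => t t1; rewrite -subr_ge0.
rewrite (_ : _ - _ = (t * (t + 1) ^+ 2)^-1).
  by rewrite invr_ge0 mulr_ge0 ?sqr_ge0//; lra.
by field; apply/andP; split; apply/eqP; lra.
Qed.

(** Decay faster than every power gives summability against every power, since
    [1 / (n + 1)^2] is summable. *)
Lemma rapid_seq_decay w : (forall k, exists C, forall n, n.+1%:R ^+ k * `|w n| <= C) ->
  w \in rapid_seq_pred R.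
Proof.
move=> hw; apply/asboolP => m; have [C hC] := hw m.+1.
have bnd n : n.+1%:R ^+ (2 * m) * `|w n| ^+ 2 <= C ^+ 2 * n.+1%:R ^- 2.
  have n0 : 0 < n.+1%:R :> R by rewrite ltr0n.
  rewrite ler_pdivlMr ?exprn_gt0// mulnC exprM -!exprMn.
  rewrite (_ : _ * _ * _ = n.+1%:R ^+ m.+1 * `|w n|); last by rewrite exprSr; ring.
  by rewrite lerXn2r ?nnegrE ?(le_trans _ (hC n))// mulr_ge0.
apply: (@le_lt_trans _ _ (C ^+ 2 * 2)%:E); last exact: ltry.
apply: lime_le.
  by apply: is_cvg_nneseries => n _ _; rewrite lee_fin mulr_ge0.
near=> n; rewrite sumEFin lee_fin big_mkord.
apply: (@le_trans _ _ (\sum_(i < n) C ^+ 2 * i.+1%:R ^- 2)).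
  by apply: ler_sum => i _; exact: bnd.
rewrite -mulr_sumr ler_wpM2l ?sqr_ge0//; exact: sum_inv_sqr.
Unshelve. all: by end_near. Qed.

Lemma num_classD u v : u \in tempered_seq_pred R -> v \in tempered_seq_pred R ->
  num_class u + num_class v = num_class (fun n => u n + v n).
Proof.
move=> hu hv; rewrite /num_class -rmorphD/=; congr (\pi__ _).
apply: val_inj; rewrite [RHS]insubdK; last exact: tempered_seqD.
by rewrite -[in RHS](insubdK (0 : tempered_seq R) hu) -[in RHS](insubdK (0 : tempered_seq R) hv).
Qed.

Lemma num_classM u v : u \in tempered_seq_pred R -> v \in tempered_seq_pred R ->
  num_class u * num_class v = num_class (fun n => u n * v n).
Proof.
move=> hu hv; rewrite /num_class -rmorphM/=; congr (\pi__ _).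
apply: val_inj; rewrite [RHS]insubdK; last exact: tempered_seqM.
by rewrite -[in RHS](insubdK (0 : tempered_seq R) hu) -[in RHS](insubdK (0 : tempered_seq R) hv).
Qed.

Lemma num_class0 : num_class (fun=> 0) = 0 :> tempered_number R.
Proof.
rewrite -[RHS](raddf0 (\pi_({ideal_quot rapid_seq R})))/num_class; congr (\pi__ _).
by apply: val_inj; rewrite [LHS]insubdK; [|exact: tempered_seq_cst].
Qed.

Lemma num_repr_tempered (a : tempered_number R) : num_repr a \in tempered_seq_pred R.
Proof. exact: tempered_seqP. Qed.

End sequences.

Section function_sequences.
Variable R : realType.
Local Open Scope quotient_scope.
Implicit Types (f g : nat -> schwartz R) (F G : tempered_genfun R) (A : set R).
Local Notation sn := (@schwartz_norm R).
Local Notation D := (@schwartz_deriv R).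
Local Notation h := (hermite R).

Lemma norm_sn m (f : schwartz R) : `|sn m f| = sn m f.
Proof. by rewrite ger0_norm ?schwartz_norm_ge0. Qed.

Lemma fun_repr_tempered F : is_tempered_fseq (fun_repr F).
Proof. by apply/asboolP; exact: tempered_fseqP. Qed.

(** The chosen representative of a class is unknown; this is the only fact about
    it that the computations with classes need. *)
Lemma fun_repr_class f : is_tempered_fseq f -> is_rapid_fseq (fun_repr (fun_class f) - f).
Proof.
move=> hf; have [h _] := fun_class_eq (fun_repr_tempered (fun_class f)) hf.
by apply: h; exact: fun_classK.
Qed.

Lemma is_tempered_fseqD f g : is_tempered_fseq f -> is_tempered_fseq g ->
  is_tempered_fseq (fun n => f n + g n).
Proof.
move=> hf hg m; apply: (tempered_seq_le (C := 1) (hf m) (hg m)) => n.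
by rewrite !norm_sn mul1r schwartz_norm_triangle.
Qed.

Lemma is_tempered_fseqZ (a : nat -> R) f : a \in tempered_seq_pred R ->
  is_tempered_fseq f -> is_tempered_fseq (fun n => a n *: f n).
Proof.
move=> ha hf m; apply: (tempered_seq_dom (C := 1) (tempered_seqM ha (hf m))) => n.
by rewrite norm_sn schwartz_normZ mul1r normrM norm_sn.
Qed.

(** Operators that are continuous for the Schwartz norms act on both
    [H_s'] and [H_s], hence on classes. *)
Lemma is_tempered_fseq_map (L : schwartz R -> schwartz R) f :
  (forall m, exists k, dominated (fun u => sn m (L u)) (sn k)) ->
  is_tempered_fseq f -> is_tempered_fseq (fun n => L (f n)).
Proof.
move=> hL hf m; have [k [C C0 hC]] := hL m.
by apply: (tempered_seq_dom (C := C) (hf k)) => n; rewrite !norm_sn.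
Qed.

Lemma is_rapid_fseq_map (L : schwartz R -> schwartz R) f :
  (forall m, exists k, dominated (fun u => sn m (L u)) (sn k)) ->
  is_rapid_fseq f -> is_rapid_fseq (fun n => L (f n)).
Proof.
move=> hL hf m; have [k [C C0 hC]] := hL m.
by apply: (rapid_seq_dom (C := C) (hf k)) => n; rewrite !norm_sn.
Qed.

Lemma is_tempered_fseqM f g : is_tempered_fseq f -> is_tempered_fseq g ->
  is_tempered_fseq (fun n => schwartzM (f n) (g n)).
Proof.
move=> hf hg m; have [k [C C0 hC]] := schwartz_normM R m.
apply: (tempered_seq_dom (C := C) (tempered_seqM (hf k) (hg k))) => n.
by rewrite normrM !norm_sn; exact: (hC (f n, g n)).
Qed.

Lemma is_rapid_fseqM f g : is_tempered_fseq f -> is_rapid_fseq g ->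
  is_rapid_fseq (fun n => schwartzM (f n) (g n)).
Proof.
move=> hf hg m; have [k [C C0 hC]] := schwartz_normM R m.
apply: (rapid_seqM (hf k) (hg k) C0) => n.
by rewrite !norm_sn; exact: (hC (f n, g n)).
Qed.

Lemma schwartz_deriv_tame m : exists k, dominated (fun u => sn m (D u)) (sn k).
Proof. by exists m.+1; exact: schwartz_norm_deriv. Qed.

Lemma fun_class_eqP f g : is_tempered_fseq f -> is_tempered_fseq g ->
  is_rapid_fseq (fun n => f n - g n) -> fun_class f = fun_class g.
Proof. by move=> hf hg h; apply/fun_class_eq. Qed.

Lemma fun_classD f g : is_tempered_fseq f -> is_tempered_fseq g ->
  fun_class f + fun_class g = fun_class (fun n => f n + g n).
Proof.
move=> hf hg; have hfg := is_tempered_fseqD hf hg.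
move: (hf) (hg) (hfg) => /asboolP tf /asboolP tg /asboolP tfg.
rewrite /fun_class -raddfD/=; congr (\pi__ _).
apply: val_inj; rewrite [RHS]insubdK//.
by rewrite -[in RHS](insubdK (0 : tempered_fseq R) tf) -[in RHS](insubdK (0 : tempered_fseq R) tg).
Qed.

Lemma genfun_deriv_class f : is_tempered_fseq f ->
  genfun_deriv (fun_class f) = fun_class (fun n => D (f n)).
Proof.
move=> hf; apply: fun_class_eqP.
- exact: is_tempered_fseq_map schwartz_deriv_tame (fun_repr_tempered _).
- exact: is_tempered_fseq_map schwartz_deriv_tame hf.
have := is_rapid_fseq_map schwartz_deriv_tame (fun_repr_class hf).
by congr is_rapid_fseq; apply/funext => n; rewrite [LHS]linearB.
Qed.

Lemma genfun_mul_class f g : is_tempered_fseq f -> is_tempered_fseq g ->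
  genfun_mul (fun_class f) (fun_class g) = fun_class (fun n => schwartzM (f n) (g n)).
Proof.
move=> hf hg; set f' := fun_repr (fun_class f); set g' := fun_repr (fun_class g).
have hg' : is_tempered_fseq g' by exact: fun_repr_tempered.
apply: fun_class_eqP.
- exact: (is_tempered_fseqM (fun_repr_tempered (fun_class f)) hg').
- exact: (is_tempered_fseqM hf hg).
have E (p q r s : R) : q * (p - r) - r * (0 - (q - s)) = p * q - r * s by ring.
have h1 := is_rapid_fseqM hg' (fun_repr_class hf).
have := is_rapid_fseqM hf (is_rapid_fseqB (@is_rapid_fseq0 R) (fun_repr_class hg)).
move=> /(is_rapid_fseqB h1).
congr is_rapid_fseq; apply/funext => n; apply: schwartz_ext => x.
transitivity (g' n x * (f' n x - f n x) - f n x * (0 - (g' n x - g n x))); first by [].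
transitivity (f' n x * g' n x - f n x * g n x); last by [].
exact: E.
Qed.

Lemma lebesgue_int_tempered A f : lebesgue_measurable A -> is_tempered_fseq f ->
  (fun n => lebesgue_int A (f n)) \in tempered_seq_pred R.
Proof.
move=> mA hf; have [C C0 hC] := lebesgue_int_dominated R.
by apply: (tempered_seq_dom (C := C) (hf 3)) => n; rewrite norm_sn; exact: hC.
Qed.

Lemma lebesgue_int_rapid A f : lebesgue_measurable A -> is_rapid_fseq f ->
  (fun n => lebesgue_int A (f n)) \in rapid_seq_pred R.
Proof.
move=> mA hf; have [C C0 hC] := lebesgue_int_dominated R.
by apply: (rapid_seq_dom (C := C) (hf 3)) => n; rewrite norm_sn; exact: hC.
Qed.

Lemma genfun_integral_class A f : lebesgue_measurable A -> is_tempered_fseq f ->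
  genfun_integral A (fun_class f) = num_class (fun n => lebesgue_int A (f n)).
Proof.
move=> mA hf; have t1 := lebesgue_int_tempered mA (fun_repr_tempered (fun_class f)).
have [_ h] := num_class_eq t1 (lebesgue_int_tempered mA hf); apply: h.
rewrite (_ : _ - _ = fun n => lebesgue_int A ((fun_repr (fun_class f) - f) n)).
  exact: lebesgue_int_rapid mA (fun_repr_class hf).
apply/funext => n.
have := lebesgue_int_linear (-1) (f n) (fun_repr (fun_class f) n) mA.
rewrite mulN1r scaleN1r => e.
transitivity (- lebesgue_int A (f n) + lebesgue_int A (fun_repr (fun_class f) n)).
  exact: addrC.
rewrite -e; congr (lebesgue_int A (schwartz_fun _)); exact: addrC.
Qed.

End function_sequences.

(** * Hermite expansions and the rules of integration *)

Section hermite_expansion.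
Variable R : realType.
Implicit Types (phi : schwartz R) (T : schwartz R -> R).
Local Notation sn := (@schwartz_norm R).
Local Notation h := (hermite R).
Local Notation N := (osc_norm (1 : R) 4^-1 2^-1).

Lemma schwartz_norm_hermite_osc m : dominated (sn m) (N (2 * m)).
Proof.
rewrite schwartz_norm_funE; apply: osc_norm_compare => //; by rewrite invr_gt0.
Qed.

Lemma schwartz_norm_hermite m : (fun n => sn m (h n)) \in tempered_seq_pred R.
Proof.
have [C C0 hC] := schwartz_norm_hermite_osc m.
apply/asboolP; exists C, (2 * m)%N => n.
by rewrite norm_sn -osc_norm_hermite.
Qed.

Lemma tempered_seq_sum (u : nat -> R) : u \in tempered_seq_pred R ->
  (forall n, 0 <= u n) -> (fun n => \sum_(j < n.+1) u j) \in tempered_seq_pred R.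
Proof.
move=> /asboolP[C [k hC]] u0; apply/asboolP; exists C, k.+1 => n.
rewrite ger0_norm; last by apply: sumr_ge0 => j _.
have C0 : 0 <= C by have := le_trans (normr_ge0 _) (hC 0%N); rewrite expr1n mulr1.
apply: (@le_trans _ _ (\sum_(j < n.+1) C * n.+1%:R ^+ k)).
  apply: ler_sum => j _; rewrite (le_trans (ler_norm _))// (le_trans (hC j))//.
  by rewrite ler_wpM2l// lerXn2r ?nnegrE ?ler0n// ler_nat; case: j.
by rewrite sumr_const card_ord exprSr mulrA mulr_natr.
Qed.

Lemma hermite_series_tempered (t : nat -> R) : t \in tempered_seq_pred R ->
  is_tempered_fseq (fun n => \sum_(j < n.+1) t j *: h j).
Proof.
move=> ht m.
have hs : (fun j => `|t j| * sn m (h j)) \in tempered_seq_pred R.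
  apply: (tempered_seq_dom (C := 1) (tempered_seqM ht (schwartz_norm_hermite m))) => j.
  by rewrite mul1r !normrM normr_id.
apply: (tempered_seq_dom (C := 1) (tempered_seq_sum hs _)) => n.
  by rewrite mulr_ge0 ?schwartz_norm_ge0.
rewrite norm_sn mul1r.
apply: (le_trans (schwartz_norm_sum m n.+1 (fun j => t j *: h j))).
apply: (le_trans _ (ler_norm _)); apply: ler_sum => j _.
by rewrite schwartz_normZ.
Qed.

Lemma hermite_coef_tempered phi : (fun j => ip phi (h j)) \in tempered_seq_pred R.
Proof.
apply: (tempered_seq_dom (C := 1) (tempered_seq_cst (l2norm phi))) => j.
rewrite mul1r (le_trans (CauchySchwarz _ _))//.
by rewrite {2}/l2norm ip_hermite eqxx sqrtr1 mulr1 ler_norm.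
Qed.

Lemma cst_tempered phi : is_tempered_fseq (fun=> phi).
Proof. by move=> m; exact: tempered_seq_cst. Qed.

Lemma hermite_rem_rapid phi : is_rapid_fseq (fun n => phi - hermite_proj n.+1 phi).
Proof.
move=> m; apply: rapid_seq_decay => k.
have [C C0 hC] := schwartz_norm_hermite_osc m.
exists (C * N (k + 2 * m) phi) => n; rewrite norm_sn.
apply: (@le_trans _ _ (C * (n.+2%:R ^+ k * N (2 * m) (phi - hermite_proj n.+1 phi)))).
  rewrite mulrCA ler_pM ?schwartz_norm_ge0 ?exprn_ge0 ?hC//.
  by rewrite lerXn2r ?nnegrE ?ler0n// ler_nat.
by rewrite ler_wpM2l// hermite_rem_decay.
Qed.

(** On Schwartz functions the embedding by Hermite sums agrees with the embedding
    by constant sequences. *)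
Lemma schwartz_iotaE phi : schwartz_iota phi = fun_class (fun=> phi).
Proof.
have E : schwartz_iota phi = fun_class (fun n => hermite_proj n.+1 phi).
  congr fun_class; apply/funext => n; apply: eq_bigr => j _; congr (_ *: _).
  by rewrite /schwartz_distribution; exact: (lebesgue_int_setT (schwartzM phi (h j))).
rewrite E; symmetry; apply: fun_class_eqP; first exact: cst_tempered.
  exact: hermite_series_tempered (hermite_coef_tempered phi).
exact: hermite_rem_rapid.
Qed.

(** Continuity at 0 and homogeneity, as for any linear form on a seminormed
    space; finitely many norms are dominated by the one of
    largest index. *)
Lemma distribution_bounded T : tempered_distribution T ->
  exists k, dominated (fun phi => `|T phi|) (sn k).
Proof.
move=> [lT cT].
have T0 : T 0 = 0.
  by have := lT (-1) 0 0; rewrite scaler0 addr0 => e; lra.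
have TZ c f : T (c *: f) = c * T f by rewrite -[c *: f]addr0 lT T0 addr0.
have [m [d [d0 hm]]] := cT 0 1 ltr01; exists m.
have [C C0 hC] : exists2 C, 0 <= C & forall k, (k <= m)%N -> forall f, sn k f <= C * sn m f.
  elim: (m) => [|i [C C0 IH]].
    by exists 1 => // k; rewrite leqn0 => /eqP -> f; rewrite mul1r.
  have [E E0 hE] := schwartz_norm_le R (leqnSn i).
  exists (C * E + 1) => [|k]; first by rewrite addr_ge0 ?mulr_ge0.
  rewrite leq_eqVlt => /orP[/eqP -> f|/IH h1 f].
    by rewrite mulrDl mul1r lerDr !mulr_ge0 ?schwartz_norm_ge0.
  rewrite (le_trans (h1 f))// mulrDl mul1r -[leLHS]addr0 lerD ?schwartz_norm_ge0//.
  by rewrite -mulrA ler_wpM2l.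
exists (2 * C / d) => [|f]; first by rewrite divr_ge0 ?mulr_ge0// ltW.
apply/ler_addgt0Pr => e e0.
(* The term in [e] keeps [s] positive when the norm of [f] vanishes. *)
pose s := C * sn m f + e * d / 2.
have s0 : 0 < s.
  by rewrite ltr_wpDl ?mulr_ge0 ?schwartz_norm_ge0// divr_gt0// mulr_gt0.
have sE : 2 * C / d * sn m f + e = 2 * s / d by rewrite /s; field; rewrite gt_eqF.
have /hm : forall k, (k <= m)%N -> sn k ((d / (2 * s)) *: f - 0) < d.
  move=> k km; rewrite subr0 schwartz_normZ ger0_norm; last first.
    by rewrite divr_ge0 ?mulr_ge0// ltW.
  rewrite mulrAC ltr_pdivrMr ?mulr_gt0// ltr_pM2l//.
  apply: (le_lt_trans (hC k km f)); rewrite /s.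
  have := mulr_gt0 e0 d0; have := mulr_ge0 C0 (schwartz_norm_ge0 m f); lra.
rewrite T0 subr0 TZ normrM ger0_norm; last by rewrite divr_ge0 ?mulr_ge0// ltW.
rewrite mulrAC ltr_pdivrMr ?mulr_gt0// mul1r => h1.
by rewrite sE ler_pdivlMr// mulrC ltW.
Qed.

Lemma distribution_sum T n (t : nat -> R) : scalar T ->
  T (\sum_(j < n) t j *: h j) = \sum_(j < n) t j * T (h j).
Proof.
move=> lT; have T0 : T 0 = 0.
  by have := lT (-1) 0 0; rewrite scaler0 addr0 => e; lra.
elim: n => [|n IH]; first by rewrite !big_ord0.
by rewrite !big_ord_recr/= addrC lT IH addrC.
Qed.

Lemma distribution_coef_tempered T : tempered_distribution T ->
  (fun j => T (h j)) \in tempered_seq_pred R.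
Proof.
move=> /distribution_bounded[k [C C0 hC]].
by apply: (tempered_seq_dom (C := C) (schwartz_norm_hermite k)) => j; rewrite norm_sn.
Qed.

(** By orthogonal expansion the integral of [T_n phi] is [T] evaluated at the
    Hermite sum of [phi], and [T] is bounded by a Schwartz norm, for which the
    remainder of [phi] is rapidly decreasing. *)
Lemma genfun_integral_iota T phi : tempered_distribution T ->
  genfun_integral setT (genfun_mul (distribution_iota T) (schwartz_iota phi)) =
  num_iota (T phi).
Proof.
move=> dT; have [lT _] := dT.
have tT := hermite_series_tempered (distribution_coef_tempered dT).
have tphi := cst_tempered phi.
rewrite schwartz_iotaE genfun_mul_class// genfun_integral_class//; last 2 first.
- exact: measurableT.
- exact: is_tempered_fseqM.
have [k [C C0 hC]] := distribution_bounded dT.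
have E n : lebesgue_int setT (schwartzM (\sum_(j < n.+1) T (h j) *: h j) phi)
    = T (hermite_proj n.+1 phi).
  rewrite lebesgue_int_setT -/(ip _ phi) ipC linear_sum/= (distribution_sum n.+1 (fun j => ip phi (h j)) lT).
  by apply: eq_bigr => j _; rewrite ipZr mulrC.
have [_ h1] := @num_class_eq R
   (fun n => lebesgue_int setT (schwartzM (\sum_(j < n.+1) T (h j) *: h j) phi))
   (fun=> T phi) (lebesgue_int_tempered measurableT (is_tempered_fseqM tT tphi))
   (tempered_seq_cst (T phi)).
have Trem n : T (phi - hermite_proj n.+1 phi) = T phi - T (hermite_proj n.+1 phi).
  by rewrite addrC -scaleN1r lT mulN1r addrC.
apply: h1; apply: (rapid_seq_dom (C := C) (hermite_rem_rapid phi k)) => n.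
rewrite -[X in `|X|]/(_ - T phi) E norm_sn.
by apply: le_trans (hC _); rewrite Trem distrC.
Qed.

Lemma genfun_integral_schwartz (A : set R) phi : lebesgue_measurable A ->
  genfun_integral A (schwartz_iota phi) = num_iota (lebesgue_int A phi).
Proof.
by move=> mA; rewrite schwartz_iotaE (genfun_integral_class mA (cst_tempered phi)).
Qed.

End hermite_expansion.

Section integral_rules.
Variable R : realType.
Implicit Types (F G : tempered_genfun R) (A B : set R).

Lemma genfun_integral_setU A B F : lebesgue_measurable A ->
  lebesgue_measurable B -> A `&` B = set0 ->
  genfun_integral (A `|` B) F = genfun_integral A F + genfun_integral B F.
Proof.
move=> mA mB AB; have tF := fun_repr_tempered F.
rewrite /genfun_integral (num_classD (lebesgue_int_tempered mA tF) (lebesgue_int_tempered mB tF)).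
by congr num_class; apply/funext => n; exact: lebesgue_int_setU.
Qed.

Lemma genfun_integral_linear A F G (a : tempered_number R) : lebesgue_measurable A ->
  genfun_integral A (F + genfun_scale a G) =
    genfun_integral A F + a * genfun_integral A G.
Proof.
move=> mA; have tF := fun_repr_tempered F; have tG := fun_repr_tempered G.
have ta := num_repr_tempered a; have taG := is_tempered_fseqZ ta tG.
rewrite -{1}(fun_classK F) (fun_classD tF taG).
rewrite (genfun_integral_class mA (is_tempered_fseqD tF taG)).
rewrite -{2}(num_classK a) /genfun_integral.
have iG := lebesgue_int_tempered mA tG.
rewrite (num_classM ta iG) (num_classD (lebesgue_int_tempered mA tF) (tempered_seqM ta iG)).
congr num_class; apply/funext => n; rewrite [RHS]addrC.
rewrite -(lebesgue_int_linear (num_repr a n) (fun_repr G n) (fun_repr F n) mA).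
by congr (lebesgue_int A (schwartz_fun _)); exact: addrC.
Qed.

Lemma genfun_integral_deriv F G :
  genfun_integral setT (genfun_mul F (genfun_deriv G)) =
  - genfun_integral setT (genfun_mul (genfun_deriv F) G).
Proof.
have tF := fun_repr_tempered F; have tG := fun_repr_tempered G.
have dF := is_tempered_fseq_map (@schwartz_deriv_tame R) tF.
have dG := is_tempered_fseq_map (@schwartz_deriv_tame R) tG.
rewrite -(fun_classK F) -(fun_classK G) (genfun_deriv_class tF) (genfun_deriv_class tG).
rewrite (genfun_mul_class tF dG) (genfun_mul_class dF tG).
have mT : lebesgue_measurable (@setT R) by exact: measurableT.
have t1 := is_tempered_fseqM tF dG; have t2 := is_tempered_fseqM dF tG.
rewrite (genfun_integral_class mT t1) (genfun_integral_class mT t2).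
have i1 := lebesgue_int_tempered mT t1; have i2 := lebesgue_int_tempered mT t2.
apply/eqP; rewrite -addr_eq0 (num_classD i1 i2); apply/eqP.
rewrite -(num_class0 R); congr num_class; apply/funext => n.
rewrite !lebesgue_int_setT -/(ip _ _) -/(ip (schwartz_deriv _) _).
by rewrite ip_deriv subrr.
Qed.

End integral_rules.

Theorem lemma5p1 (R : realType) (F G : tempered_genfun R)
    (a : tempered_number R) (alpha : nat) (A : set R)
    (alpha_gt0 : (0 < alpha)%N) (mA : lebesgue_measurable A) :
  (* (a) *)
  (forall B : set R, lebesgue_measurable B -> A `&` B = set0 ->
     genfun_integral (A `|` B) F = genfun_integral A F + genfun_integral B F) /\
  (* (b) *)
  genfun_integral A (F + genfun_scale a G) =
    genfun_integral A F + a * genfun_integral A G /\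
  (* (c) *)
  (forall phi : schwartz R,
     num_iota (lebesgue_int A phi) =
     genfun_integral A (schwartz_iota phi)) /\
  (* (d) *)
  genfun_integral setT (genfun_mul F (iter alpha (@genfun_deriv R) G)) =
    (-1) ^+ alpha *
    genfun_integral setT (genfun_mul (iter alpha (@genfun_deriv R) F) G) /\
  (* (e) *)
  (forall (phi : schwartz R) (T : schwartz R -> R), tempered_distribution T ->
     genfun_integral setT (genfun_mul (distribution_iota T) (schwartz_iota phi)) =
     num_iota (T phi)).
Proof.
split; [|split; [|split; [|split]]].
- by move=> B mB AB; exact: genfun_integral_setU.
- exact: genfun_integral_linear.
- by move=> phi; rewrite genfun_integral_schwartz.
- elim: alpha {alpha_gt0} F => [|n IH] F; first by rewrite expr0 mul1r.
  rewrite iterS genfun_integral_deriv (IH (genfun_deriv F)) -iterSr.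
  by rewrite exprS mulN1r mulNr.
- by move=> phi T; exact: genfun_integral_iota.
Qed.
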